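(* Let $T>0$, $D=(0,1)$, let $u$ be the stochastic convolution $u(t,x)=\int_0^t\int_D G(t-s;x,y)\,dW(s,y)$, and, for ${\sf M}_\star,{\sf N}_\star\in\mathbb N$ and $\Delta t=T/{\sf N}_\star$, let $\widehat u$ be the solution of the approximate problem with the spectral-type load $\widehat W$ (all defined in the context). Then there exists a constant $C>0$, independent of $\Delta t$ and ${\sf M}_\star$, such that $$\max_{t\in[0,T]}\Big(\mathbb E\big[\|u(t,\cdot)-\widehat u(t,\cdot)\|_{L^2(D)}^2\big]\Big)^{1/2}\le C\left(\Delta t^{\frac38}+\delta^{-\frac12}\,{\sf M}_\star^{-\frac32+\delta}\right)\qquad\forall\,\delta\in\left(0,\tfrac32\right].$$
   Context: $T>0$ is fixed, $D=(0,1)$, $(\Omega,\mathcal F,P)$ is a complete probability space, $\mathbb E$ is expectation, and $\dot W$ is a space-time white noise on $[0,T]\times D$; for deterministic $\Phi\in L^2((0,T)\times D)$, $\int_0^T\int_D\Phi\,dW$ denotes the corresponding (centered Gaussian) Wiener integral, with $\mathbb E[(\int_0^T\int_D\Phi\,dW)^2]=\int_0^T\int_D\Phi^2\,dx\,dt$. For $k\in\mathbb N=\{1,2,\dots\}$: $\lambda_k:=k\pi$, $\varepsilon_k(z):=\sqrt2\sin(\lambda_k z)$, and $G(t;x,y):=\sum_{k=1}^\infty e^{-\lambda_k^4t}\varepsilon_k(x)\varepsilon_k(y)$ for $t>0$, $x,y\in\overline D$. The function $u$ is the mild solution of $v_t+v_{xxxx}=\dot W$ in $(0,T]\times D$, with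 $v=v_{xx}=0$ on $\partial D$ and $v(0,\cdot)=0$. Approximate problem: let ${\sf M}_\star,{\sf N}_\star\in\mathbb N$, $\Delta t:=T/{\sf N}_\star$, $t_n:=n\Delta t$, $T_n:=(t_{n-1},t_n)$. Put ${\sf R}_i^n:=\int_{T_n}\int_D\varepsilon_i(x)\,dW(t,x)$ (independent $N(0,\Delta t)$ random variables) and $$\widehat W(t,x):=\tfrac1{\Delta t}\sum_{i=1}^{{\sf M}_\star}{\sf R}_i^n\,\varepsilon_i(x),\qquad t\in T_n,\ x\in D,\ n=1,\dots,{\sf N}_\star.$$ $\widehat u$ is the solution of $\widehat u_t+\widehat u_{xxxx}=\widehat W$ in $(0,T]\times D$, $\widehat u=\widehat u_{xx}=0$ on $\partial D$ for $t\in(0,T]$, $\widehat u(0,\cdot)=0$; equivalently $\widehat u(t,x)=\int_0^t\int_D G(t-s;x,y)\widehat W(s,y)\,dy\,ds$. *)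

(* Defs.v *)
From HB Require Import structures.
From mathcomp Require Import all_boot all_order all_algebra.
From mathcomp Require Import all_classical all_reals all_analysis.

Set Implicit Arguments.
Unset Strict Implicit.
Unset Printing Implicit Defensive.
Import Order.TTheory GRing.Theory Num.Theory.
Import numFieldNormedType.Exports.
Local Open Scope classical_set_scope.
Local Open Scope ring_scope.

Section kernel.
Context {R : realType}.

Definition domD : set R := `]0, 1[.

Definition lambda (k : nat) : R := k%:R * pi.

Definition eps (k : nat) (z : R) : R := Num.sqrt 2 * sin (lambda k * z).

(* The series converges only for t > 0; G is never used at other times. *)
Definition G (t x y : R) : R :=
  limn (fun n => \sum_(1 <= k < n.+1)
    expR (- (lambda k ^+ 4 * t)) * eps k x * eps k y).

End kernel.

Section white_noise.
Context {R : realType} {d : measure_display} {Omega : measurableType d}.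
Variables (P : probability Omega R) (T : R).

Definition cylinder : set (R * R) := `]0, T[ `*` domD.

Local Notation mu2 := (@lebesgue_measure R \x @lebesgue_measure R)%E.

Definition sqnorm_cylinder (Phi : R * R -> R) : \bar R :=
  (\int[mu2]_(z in cylinder) ((Phi z) ^+ 2)%:E)%E.

Definition L2_cylinder (Phi : R * R -> R) : Prop :=
  measurable_fun cylinder Phi /\ (sqnorm_cylinder Phi < +oo)%E.

(* X ~ N(0, v).  The case v = 0 is separate because [normal_prob m 0] is not
   the Dirac mass at m in the library. *)
Definition centered_gaussian (X : {RV P >-> R}) (v : R) : Prop :=
  if v == 0 then {ae P, forall w, X w = 0}
  else 0 < v /\
       forall A, measurable A -> distribution P X A = normal_prob 0 (Num.sqrt v) A.

(* Space-time white noise on [0, T] x D, given as the isonormal Gaussian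
   process of L^2((0, T) x D): W Phi is the Wiener integral of Phi, and the
   noise of a Borel set A is W \1_A.  Linearity makes the family jointly
   Gaussian.  Nothing is required of W outside L^2. *)
Record space_time_white_noise (W : (R * R -> R) -> {RV P >-> R}) : Prop := {
  white_noise_linear : forall (a b : R) (Phi Psi : R * R -> R),
    L2_cylinder Phi -> L2_cylinder Psi ->
    {ae P, forall w,
      W (fun z => a * Phi z + b * Psi z) w = a * W Phi w + b * W Psi w} ;
  white_noise_isometry : forall Phi : R * R -> R, L2_cylinder Phi ->
    ('E_P[fun w => (W Phi w ^+ 2)%R] = sqnorm_cylinder Phi)%E ;
  white_noise_gaussian : forall Phi : R * R -> R, L2_cylinder Phi ->
    centered_gaussian (W Phi) (fine (sqnorm_cylinder Phi)) }.

Variable W : (R * R -> R) -> {RV P >-> R}.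

(* For each (t, x) the Wiener integral is determined only up to a null set, so
   u is any version of the stochastic convolution that is jointly measurable in
   (x, omega), as is needed for the expectation of a norm in L^2(D). *)
Definition stochastic_convolution (u : R -> R -> Omega -> R) : Prop :=
  forall t : R, t \in `[0, T] ->
    measurable_fun (domD `*` [set: Omega])
      (fun z : R * Omega => u t z.1 z.2) /\
    forall x, x \in domD ->
      {ae P, forall w,
        u t x w = W (fun z => \1_(`]0, t[) z.1 * G (t - z.1) x z.2) w}.

Section approximation.
Variables (M N : nat).

Definition dt : R := T / N%:R.

Definition time_slab (n : nat) : set R := `]n.-1%:R * dt, n%:R * dt[.

Definition noise_coef (i n : nat) : {RV P >-> R} :=
  W (fun z => \1_(time_slab n) z.1 * eps i z.2).

(* What is 0 at the grid points n * dt, a null set. *)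
Definition What (t x : R) (w : Omega) : R :=
  \sum_(1 <= n < N.+1) \1_(time_slab n) t *
    (dt^-1 * \sum_(1 <= i < M.+1) noise_coef i n w * eps i x).

(* The solution of v_t + v_xxxx = What with v = v_xx = 0 on the boundary and
   v(0, .) = 0, for each omega, through Duhamel's formula with the Green's
   function G. *)
Definition uhat (t x : R) (w : Omega) : R :=
  \int[lebesgue_measure]_(s in `]0, t[)
    \int[lebesgue_measure]_(y in domD) (G (t - s) x y * What s y w).

End approximation.

End white_noise.

(* (E[ || v - v' ||_{L^2(D)}^2 ])^{1/2}, in extended reals *)
Definition rms_L2_dist {R : realType} {d : measure_display}
    {Omega : measurableType d} (P : probability Omega R)
    (v v' : R -> Omega -> R) : \bar R :=
  ((\int[P]_w \int[lebesgue_measure]_(x in domD) ((v x w - v' x w) ^+ 2)%:E)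
    `^ (1 / 2)%R)%E.

Definition is_max_on {R : realType} (A : set R) (f : R -> \bar R) (m : \bar R)
    : Prop :=
  (exists2 t, t \in A & f t = m) /\ forall t, t \in A -> (f t <= m)%E.

(* Main.v *)
(** By the isometry and Tonelli, the mean square error at time t is the integral
over x of the squared L^2 norm of the difference of two kernels, both sine
series in y.  Parseval in y and then in x turns it into the sum over k of
err_k(t) = || f_k - g_k ||^2 in L^2(0, T), where f_k(s) = e^{-lambda_k^4 (t - s)}
on (0, t), and g_k is the mean of f_k over each time slab if k <= M, and 0
otherwise.  Always err_k <= k^-4.  For k <= M also err_k <= 2 dt, as f_k is
monotone with values in [0, 1] up to its jump at t.  Hence the sum is at most
8 dt^{3/4} + M^-3.  It converges uniformly in t, so it is continuous and attains
its maximum on [0, T]. *)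

Require Import Defs.
From HB Require Import structures.
From mathcomp Require Import all_boot all_order all_algebra.
From mathcomp Require Import all_classical all_reals all_analysis.
From mathcomp Require Import measurable_realfun ring lra.
Import Order.TTheory GRing.Theory Num.Theory.
Import numFieldNormedType.Exports.
Local Open Scope classical_set_scope.
Local Open Scope ring_scope.

Set Implicit Arguments.
Unset Strict Implicit.
Unset Printing Implicit Defensive.

(** * Integrals over bounded intervals *)

Section calculus.
Context {R : realType}.
Implicit Types (f F : R -> R) (a b : R).
Local Notation leb := (@lebesgue_measure R).

(** Linearity of [W] is available only almost surely and for finite combinations, so no infinite
    series is ever moved through [W]. The load has finitely many modes on finitely many slabs:
    [uhat] is a finite combination of the [noise_coef], hence the Wiener integral of one kernel; [u]
    is the Wiener integral of another, and a single subtraction precedes the isometry. The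
    projection g_k is forced: Duhamel's formula integrates e^{-lambda_k^4 (t - s)} over each slab
    cut at t and the load divides by dt, which gives the slab means of f_k.

    The coefficients f_k(s) decay in k with no uniformity as s tends to t from below. Parseval in y
    is therefore applied at each fixed s, where the series converges absolutely, and the integral
    over s is exchanged with a sum of squares, which are nonnegative.

    The two bounds on err_k cross at k near dt^{-1/4}; summing the smaller one gives dt^{3/4}, whose
    square root is the exponent 3/8.

    In the lemmas modes and slabs are counted from 0: index k stands for [eps k.+1], index n for
    slab [n.+1]. *)

Lemma Rintegral_oo_antiderivative f F a b : a <= b -> continuous f ->
  (forall x : R, is_derive x 1 F (f x)) ->
  \int[leb]_(x in `]a, b[) f x = F b - F a.
Proof.
move=> ab cf dF; move: ab; rewrite le_eqVlt => /predU1P[<-|ab].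
  by rewrite set_itvoo0// Rintegral_set0 subrr.
have cF : continuous F.
  by move=> x; apply/differentiable_continuous/derivable1_diffP; exact: ex_derive.
have fab : {within `[a, b], continuous f} by exact: continuous_subspaceT.
have icc : leb.-integrable `[a, b] (EFin \o f).
  by apply: continuous_compact_integrable => //; exact: segment_compact.
rewrite Rintegral_itv_obnd_cbnd; last first.
  by apply: integrableS icc => //; exact: subset_itv_oo_cc.
rewrite Rintegral_itv_bndo_bndc; last first.
  by apply: integrableS icc => //; exact: subset_itv_co_cc.
rewrite /Rintegral (@continuous_FTC2 _ f F) //.
- split.
  + by move=> x _; exact: ex_derive.
  + by apply: cvg_at_right_filter; exact: cF.
  + by apply: cvg_at_left_filter; exact: cF.
- by move=> x _; rewrite derive1E; exact: derive_val.
Qed.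

Lemma is_derive_affine_comp (F : R -> R) (k w v x dF : R) :
  is_derive (w * x + v) 1 F dF ->
  is_derive x 1 (fun y : R => k * F (w * y + v)) (k * (dF * w)).
Proof.
move=> FdF.
have dw : is_derive x 1 (fun y : R => w * y + v) w.
  have -> : (fun y : R => w * y + v) = (w \*: @id R) + cst v by [].
  by apply: is_derive_eq; rewrite addr0 /GRing.scale/= mulr1.
have -> : (fun y : R => k * F (w * y + v)) =
    k \*: (F \o (fun y : R => w * y + v)) by [].
have FdF' := @is_derive1_comp _ F (fun y : R => w * y + v) x dF w FdF dw.
exact: (is_deriveZ k FdF').
Qed.

Lemma bounded_integrable_oo f a b B : measurable_fun `]a, b[ f ->
  (forall x, x \in `]a, b[ -> `|f x| <= B) -> leb.-integrable `]a, b[ (EFin \o f).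
Proof.
move=> mf fB; apply: measurable_bounded_integrable => //.
  have : (leb `]a, b[%classic < +oo)%E.
    by rewrite lebesgue_measure_itv/=; case: ifP => // _; rewrite -EFinD ltry.
  by [].
exists B; split; first exact: num_real.
by move=> x Bx y yab; apply: le_trans (ltW Bx); exact: fB.
Qed.

Lemma integrableB_EFin (D : set R) (f g : R -> R) : measurable D ->
  leb.-integrable D (EFin \o f) -> leb.-integrable D (EFin \o g) ->
  leb.-integrable D (EFin \o (fun x => f x - g x)).
Proof.
move=> mD fi gi.
have -> : EFin \o (fun x => f x - g x) = ((EFin \o f) \- (EFin \o g))%E by [].
exact: integrableB.
Qed.

Lemma integrable_sum_EFin (D : set R) (f : nat -> R -> R) (r : seq nat) :
  measurable D -> (forall n, leb.-integrable D (EFin \o f n)) ->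
  leb.-integrable D (EFin \o (fun x => \sum_(n <- r) f n x)).
Proof.
move=> mD fi.
have -> : EFin \o (fun x => \sum_(n <- r) f n x) =
    (fun x => \sum_(n <- r) (EFin \o f n) x)%E.
  by apply/funext => x /=; rewrite sumEFin.
exact: integrable_sum.
Qed.

Lemma Rintegral_sum (D : set R) (f : nat -> R -> R) (r : seq nat) :
  measurable D -> (forall n, leb.-integrable D (EFin \o f n)) ->
  \int[leb]_(x in D) (\sum_(n <- r) f n x) = \sum_(n <- r) \int[leb]_(x in D) f n x.
Proof.
move=> mD fi; elim: r => [|n r IH].
  rewrite big_nil; under eq_Rintegral do rewrite big_nil.
  by rewrite Rintegral_cst// mul0r.
rewrite big_cons -IH -RintegralD//; last exact: integrable_sum_EFin.
by apply: eq_Rintegral => x _; rewrite big_cons.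
Qed.

End calculus.

Lemma sum_nat_tail0 {V : nmodType} (F : nat -> V) m n : (m <= n)%N ->
  (forall k, (m <= k)%N -> F k = 0) ->
  \sum_(0 <= k < n) F k = \sum_(0 <= k < m) F k.
Proof.
move=> mn F0; rewrite (@big_cat_nat _ _ _ m 0 n)//=.
rewrite [X in _ + X = _]big_nat_cond [X in _ + X = _]big1 ?addr0//.
by move=> k /andP[/andP[/F0]].
Qed.

Lemma cvg_series_mull {R : realType} (c l : R) (u : nat -> R) :
  series u @ \oo --> l -> series (fun k => c * u k) @ \oo --> c * l.
Proof.
move=> ul.
have -> : series (fun k => c * u k) = (fun n => c * series u n).
  by apply/funext => n; rewrite /series/= mulr_sumr.
by apply: cvgM => //; exact: cvg_cst.
Qed.

(** * Absolutely convergent sine series *)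

Section sine_basis.
Context {R : realType}.
Local Notation leb := (@lebesgue_measure R).
Local Notation D := (@domD R).
Implicit Types (j k n : nat) (x y : R).

Lemma sin_natpi n : sin (n%:R * pi) = 0 :> R.
Proof.
elim: n => [|n IH]; first by rewrite mul0r sin0.
by rewrite -natr1 mulrDl mul1r sinDpi IH oppr0.
Qed.

Lemma int_cos_natpi n :
  \int[leb]_(x in D) cos (n%:R * pi * x) = (n == 0%N)%:R.
Proof.
have cc : continuous (fun x : R => cos (n%:R * pi * x)).
  move=> x; apply: (@continuous_comp _ _ _ (fun x => n%:R * pi * x) cos).
    by apply: cvgM; [exact: cvg_cst|exact: cvg_id].
  exact: continuous_cos.
have [->|n0] := eqVneq n 0%N.
  rewrite (_ : (fun x => _) = fun=> 1).
    rewrite (@Rintegral_oo_antiderivative _ (fun=> 1) id 0 1) ?subr0//.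
    by move=> x; exact: cvg_cst.
  by apply/funext => x; rewrite !mul0r cos0.
have w0 : n%:R * pi != 0 :> R.
  by apply: mulf_neq0; [rewrite pnatr_eq0|rewrite gt_eqF// pi_gt0].
pose F (y : R) := (n%:R * pi)^-1 * sin (n%:R * pi * y + 0).
have dF (x : R) : is_derive x 1 F (cos (n%:R * pi * x)).
  have := is_derive_affine_comp (n%:R * pi)^-1 (is_derive_sin (n%:R * pi * x + 0)).
  by rewrite addr0 mulrCA mulVf ?mulr1.
rewrite (Rintegral_oo_antiderivative ler01 cc dF) /F.
by rewrite !addr0 mulr1 mulr0 sin0 sin_natpi mulr0 subrr.
Qed.

Lemma continuous_eps k : continuous (@eps R k).
Proof.
move=> x; apply: cvgM; first exact: cvg_cst.
apply: (@continuous_comp _ _ _ (fun x => lambda k * x) sin).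
  by apply: cvgM; [exact: cvg_cst|exact: cvg_id].
exact: continuous_sin.
Qed.

Lemma measurable_eps k A : measurable_fun A (@eps R k).
Proof.
apply: measurable_funTS; apply: continuous_measurable_fun; exact: continuous_eps.
Qed.

Lemma norm_eps_le k x : `|eps k x| <= 2.
Proof.
rewrite /eps normrM -[leRHS]mulr1 ler_pM ?sin_max//.
by rewrite ger0_norm ?sqrtr_ge0// -[leRHS](@ger0_norm _ 2)// -sqrtr_sqr ler_sqrt// expr2; lra.
Qed.


(** 2 sin(a) sin(b) = cos(a - b) - cos(a + b): the frequency [j + k + 2] never vanishes, so only the
    first cosine can have a nonzero integral, and it does exactly when [j = k]. *)
Lemma int_eps_eps j k :
  \int[leb]_(x in D) (eps j.+1 x * eps k.+1 x) = (j == k)%:R.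
Proof.
(* With [k <= j] the truncated subtraction [j - k] is the true one. *)
wlog jk : j k / (k <= j)%N.
  move=> H; have [/H//|/ltnW/H] := leqP k j.
  by rewrite eq_sym => <-; apply: eq_Rintegral => x _; rewrite mulrC.
have icos n : leb.-integrable D (EFin \o (fun x => cos (n%:R * pi * x))).
  apply: (@bounded_integrable_oo _ _ _ _ 1) => [|x _]; last exact: cos_max.
  apply: measurable_funTS; apply: continuous_measurable_fun => x.
  apply: (@continuous_comp _ _ _ (fun x => n%:R * pi * x) cos).
    by apply: cvgM; [exact: cvg_cst|exact: cvg_id].
  exact: continuous_cos.
transitivity (\int[leb]_(x in D) (cos ((j - k)%:R * pi * x) - cos ((j + k).+2%:R * pi * x))).
  apply: eq_Rintegral => x _; rewrite /eps /lambda.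
  rewrite mulrACA -expr2 sqr_sqrtr// natrB// -[(j + k).+2]addn2 (natrD _ (j + k)) (natrD _ j).
  rewrite (_ : (j%:R - k%:R) * pi * x = j.+1%:R * pi * x - k.+1%:R * pi * x); last first.
    by rewrite -!natr1; ring.
  rewrite (_ : (j%:R + k%:R + 2%:R) * pi * x = j.+1%:R * pi * x + k.+1%:R * pi * x); last first.
    by rewrite -!natr1; ring.
  by rewrite cosB cosD; ring.
rewrite RintegralB ?int_cos_natpi//; last exact: measurable_itv.
by rewrite subr0 subn_eq0 eqn_leq jk andbT.
Qed.

(* The coefficient of eps k.+1 is a k: eps 0 is the zero function. *)
Definition sine_series (a : nat -> R) (x : R) : R :=
  limn (series (fun k => a k * eps k.+1 x)).

Implicit Types (a b : nat -> R).

Definition summable_seq a := cvgn (series (fun k => `|a k|)).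

Lemma summable_seq_le a b : (forall k, `|a k| <= b k) -> cvgn (series b) ->
  summable_seq a.
Proof.
move=> ab; apply: series_le_cvg => // k; apply: le_trans (ab k); exact: normr_ge0.
Qed.

Lemma is_cvg_sine_series a x : summable_seq a ->
  cvgn (series (fun k => a k * eps k.+1 x)).
Proof.
move=> sa; apply: normed_cvg.
apply: (@series_le_cvg _ _ (fun k => 2 * `|a k|)).
- by move=> k; exact: normr_ge0.
- by move=> k; exact: mulr_ge0.
- by move=> k; rewrite /= normrM mulrC ler_wpM2r// norm_eps_le.
- by apply/cvg_ex; eexists; exact: cvg_series_mull sa.
Qed.

Lemma cvg_sine_series a x : summable_seq a ->
  series (fun k => a k * eps k.+1 x) @ \oo --> sine_series a x.
Proof. by move=> sa; exact: is_cvg_sine_series. Qed.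

Lemma norm_sine_partial_le a n x : summable_seq a ->
  `|series (fun k => a k * eps k.+1 x) n| <= 2 * limn (series (fun k => `|a k|)).
Proof.
move=> sa; rewrite /series/=.
apply: (le_trans (ler_norm_sum _ _ _)).
apply: (@le_trans _ _ (2 * \sum_(0 <= k < n) `|a k|)).
  rewrite mulr_sumr; apply: ler_sum => k _.
  by rewrite normrM mulrC ler_wpM2r// norm_eps_le.
rewrite ler_wpM2l//; apply: (@nondecreasing_cvgn_le _ (series (fun k => `|a k|))) => //.
by apply: nondecreasing_series => k _ _.
Qed.

Lemma norm_sine_series_le a x : summable_seq a ->
  `|sine_series a x| <= 2 * limn (series (fun k => `|a k|)).
Proof.
move=> sa; have c := @cvg_sine_series a x sa.
rewrite -(cvg_lim (@Rhausdorff R) (cvg_norm c)).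
apply: limr_le; first by apply/cvg_ex; exists `|sine_series a x|; exact: cvg_norm c.
by near=> n; exact: norm_sine_partial_le.
Unshelve. all: by end_near. Qed.

Lemma measurable_sine_series a : summable_seq a -> measurable_fun D (sine_series a).
Proof.
move=> sa.
apply: (@measurable_fun_cvg _ _ _ _ (fun n x => series (fun k => a k * eps k.+1 x) n)).
  move=> n; apply: measurable_sum => k; apply: measurable_funM => //.
  exact: measurable_eps.
by move=> x _; exact: cvg_sine_series.
Qed.

(** Dominated convergence: the partial sums are bounded, uniformly in n and x, by twice the sum of
    the |a_k|. Two choices of [phi] matter: a basis function, which gives the coefficients, and the
    series itself, which gives Parseval. *)
Lemma sine_series_pairing a (phi : R -> R) (B : R) : summable_seq a ->
  measurable_fun D phi -> (forall x, x \in D -> `|phi x| <= B) ->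
  series (fun k => a k * \int[leb]_(x in D) (eps k.+1 x * phi x)) @ \oo -->
  \int[leb]_(x in D) (sine_series a x * phi x).
Proof.
move=> sa mphi phiB.
have mD : measurable D by exact: measurable_itv.
pose S n (x : R) : R := series (fun k => a k * eps k.+1 x) n.
have mS n : measurable_fun D (S n).
  by apply: measurable_sum => k; apply: measurable_funM => //; exact: measurable_eps.
have bphi k x : x \in D -> `|eps k.+1 x * phi x| <= 2 * B.
  by move=> xD; rewrite normrM ler_pM ?norm_eps_le// phiB.
have mephi k : measurable_fun D (fun x => eps k.+1 x * phi x).
  by apply: measurable_funM => //; exact: measurable_eps.
have iephi k : leb.-integrable D (EFin \o (fun x => eps k.+1 x * phi x)).
  apply: (@bounded_integrable_oo _ _ _ _ (2 * B)) => // x xD.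
  by apply: bphi; rewrite inE.
have iphi k : leb.-integrable D (EFin \o (fun x => a k * (eps k.+1 x * phi x))).
  apply: (@bounded_integrable_oo _ _ _ _ (`|a k| * (2 * B))).
    exact: measurable_funM.
  by move=> x xD; rewrite normrM ler_wpM2l// bphi// inE.
pose L := 2 * limn (series (fun k => `|a k|)).
have bS n x : x \in D -> `|S n x * phi x| <= L * B.
  by move=> xD; rewrite normrM ler_pM ?phiB//; exact: norm_sine_partial_le.
have [] := @dominated_convergence _ _ R leb D mD (fun n x => (S n x * phi x)%:E)
  (fun x => (sine_series a x * phi x)%:E) (fun=> (L * B)%:E).
- by move=> n; apply/measurable_EFinP; apply: measurable_funM => //; exact: mS.
- by apply/measurable_EFinP; apply: measurable_funM => //; exact: measurable_sine_series.
- apply/aeW => x _ /=; apply: cvg_EFin; first exact: nearW.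
  by apply: cvgM; [exact: cvg_sine_series|exact: cvg_cst].
- exact: (@bounded_integrable_oo _ (fun=> L * B) 0 1 `|L * B|).
- by apply/aeW => x n xD; rewrite lee_fin bS ?inE.
move=> iS _ c.
have E n : (\int[leb]_(x in D) (S n x * phi x)%:E)%E =
   (series (fun k => a k * \int[leb]_(x in D) (eps k.+1 x * phi x)) n)%:E.
  transitivity ((\int[leb]_(x in D) (\sum_(0 <= k < n) (a k * (eps k.+1 x * phi x))%:E))%E).
    apply: eq_integral => x _; rewrite /S /series /= sumEFin mulr_suml; congr (_%:E).
    by apply: eq_bigr => k _; rewrite mulrA.
  rewrite integral_sum// -sumEFin; apply: eq_bigr => k _.
  rewrite -RintegralZl// /Rintegral fineK//.
  by apply: integrable_fin_num => //; exact: iphi.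
have c' : (fun n => (series (fun k => a k * \int[leb]_(x in D) (eps k.+1 x * phi x)) n)%:E)
    @ \oo --> (\int[leb]_(x in D) (sine_series a x * phi x)%:E)%E.
  by under eq_fun do rewrite -E.
rewrite -[X in _ --> X]fineK in c'; last exact: integrable_fin_num.
exact: fine_cvg c'.
Qed.

Lemma sine_series_coef a j : summable_seq a ->
  \int[leb]_(x in D) (sine_series a x * eps j.+1 x) = a j.
Proof.
move=> sa.
have c := sine_series_pairing sa (@measurable_eps j.+1 D) (fun x _ => norm_eps_le j.+1 x).
rewrite -(cvg_lim (@Rhausdorff R) c); apply: lim_near_cst => //.
near=> n.
rewrite /series/= (bigD1_seq j) /= ?iota_uniq//; last first.
  by rewrite mem_index_iota/=; near: n; exact: nbhs_infty_gt.
rewrite int_eps_eps eqxx mulr1 big1 ?addr0// => k kj.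
by rewrite int_eps_eps (negPf kj) mulr0.
Unshelve. all: by end_near. Qed.

Lemma sine_series_parseval a : summable_seq a ->
  series (fun k => a k ^+ 2) @ \oo --> \int[leb]_(x in D) (sine_series a x ^+ 2).
Proof.
move=> sa.
have c := sine_series_pairing sa (measurable_sine_series sa)
  (fun x _ => norm_sine_series_le x sa).
have E : (fun k => a k * \int[leb]_(x in D) (eps k.+1 x * sine_series a x)) =
    (fun k => a k ^+ 2).
  apply/funext => k; rewrite expr2 -{3}(sine_series_coef k sa); congr (_ * _).
  by apply: eq_Rintegral => x _; rewrite mulrC.
by rewrite E in c.
Qed.

Lemma sine_seriesB a b x : summable_seq a -> summable_seq b ->
  sine_series (fun k => a k - b k) x = sine_series a x - sine_series b x.
Proof.
move=> sa sb; apply: (cvg_lim (@Rhausdorff R)).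
have -> : series (fun k => (a k - b k) * eps k.+1 x) =
    (fun n => series (fun k => a k * eps k.+1 x) n - series (fun k => b k * eps k.+1 x) n).
  by apply/funext => n; rewrite /series/= -sumrB; apply: eq_bigr => k _; rewrite mulrBl.
by apply: cvgB; exact: cvg_sine_series.
Qed.

Lemma summable_seqB a b : summable_seq a -> summable_seq b ->
  summable_seq (fun k => a k - b k).
Proof.
move=> sa sb; apply: (@summable_seq_le _ (fun k => `|a k| + `|b k|)).
  by move=> k; exact: ler_normB.
have := is_cvg_seriesD sa sb.
by [].
Qed.

Lemma summable_seq_finite a m : (forall k, (m <= k)%N -> a k = 0) -> summable_seq a.
Proof.
move=> a0; apply/cvg_ex; exists (series (fun k => `|a k|) m).
apply: cvg_near_cst; near=> n.
apply: sum_nat_tail0 => [|k mk]; first by near: n; exact: nbhs_infty_ge.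
by rewrite a0 ?normr0.
Unshelve. all: by end_near. Qed.

Lemma sine_series_finite a m x : (forall k, (m <= k)%N -> a k = 0) ->
  sine_series a x = \sum_(0 <= k < m) a k * eps k.+1 x.
Proof.
move=> a0; apply: lim_near_cst => //; near=> n.
apply: sum_nat_tail0 => [|k mk]; first by near: n; exact: nbhs_infty_ge.
by rewrite a0 ?mul0r.
Unshelve. all: by end_near. Qed.

End sine_basis.
Lemma continuous_sum_seq {R : realType} {X : topologicalType} (r : seq nat)
    (f : nat -> X -> R) :
  (forall n, continuous (f n)) -> continuous (fun x => \sum_(n <- r) f n x).
Proof.
move=> cf; elim: r => [|n r IH].
  by under eq_fun do rewrite big_nil; move=> x; exact: cvg_cst.
under eq_fun do rewrite big_cons.
by move=> x; apply: cvgD; [exact: cf|exact: IH].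
Qed.

(** * The modes f_k and their projections onto step functions *)

Section exponential_modes.
Context {R : realType}.
Local Notation leb := (@lebesgue_measure R).
Implicit Types (m t s a b : R) (n : nat).

Lemma continuous_expR_affine (w v : R) : continuous (fun s : R => expR (w * s + v)).
Proof.
move=> s; apply: (@continuous_comp _ _ _ (fun s => w * s + v) expR); last exact: continuous_expR.
by apply: cvgD; [apply: cvgM; [exact: cvg_cst|exact: cvg_id]|exact: cvg_cst].
Qed.

Lemma int_expR_decay m t a b : m != 0 -> a <= b ->
  \int[leb]_(s in `]a, b[) expR (- (m * (t - s))) =
  (expR (- (m * (t - b))) - expR (- (m * (t - a)))) / m.
Proof.
move=> m0 ab.
have E s : - (m * (t - s)) = m * s + (- (m * t)) by ring.
pose F (s : R) := m^-1 * expR (m * s + (- (m * t))).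
have dF (s : R) : is_derive s 1 F (expR (m * s + (- (m * t)))).
  have := is_derive_affine_comp m^-1 (is_derive_expR (m * s + (- (m * t)))).
  by rewrite mulrCA mulVf ?mulr1.
under eq_Rintegral do rewrite E.
rewrite (Rintegral_oo_antiderivative ab (@continuous_expR_affine m (- (m * t))) dF) /F.
by rewrite !E -mulrBr mulrC.
Qed.

Lemma Rintegral_indicM (D A : set R) (f : R -> R) : A `<=` D ->
  \int[leb]_(s in D) (\1_A s * f s) = \int[leb]_(s in A) f s.
Proof.
move=> AD; rewrite -[in RHS](setIidr AD) Rintegral_mkcondr; apply: eq_Rintegral => s _.
by rewrite patchE indicE; case: ifP => _; rewrite ?mul1r ?mul0r.
Qed.

(** For m = lambda_k^4 this is f_k, extended by 0 off (0, t). All coefficients thus vanish for s >=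
    t, where the exponentials would not be summable in k. *)
Definition decay m t s : R := \1_(`]0, t[) s * expR (- (m * (t - s))).

Lemma decay_ge0 m t s : 0 <= decay m t s.
Proof. by rewrite /decay mulr_ge0 ?expR_ge0// indicE. Qed.

Lemma decay_le1 m t s : 0 <= m -> decay m t s <= 1.
Proof.
move=> m0; rewrite /decay indicE; case: (boolP (s \in _)) => [|_]; last by rewrite mul0r.
rewrite inE/= in_itv/= => /andP[_ st]; rewrite mul1r -expR0 ler_expR oppr_le0.
by rewrite mulr_ge0// subr_ge0 ltW.
Qed.

Lemma measurable_decay m t A : measurable_fun A (decay m t).
Proof.
apply: measurable_funTS; apply: measurable_funM; first exact: measurable_indic.
apply: continuous_measurable_fun.
have -> : (fun s => expR (- (m * (t - s)))) = (fun s => expR (m * s + (- (m * t)))).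
  by apply/funext => s; congr expR; ring.
exact: continuous_expR_affine.
Qed.

Lemma decay_sqr m t s : decay m t s ^+ 2 = decay (2 * m) t s.
Proof.
rewrite /decay exprMn -expRM_natl indicE; congr (_ * expR _); last by ring.
by case: (s \in _); rewrite ?expr1n ?expr0n.
Qed.

(** The integral of [decay m t]. By [decay_sqr], its value at rate [2 * m] is the squared L^2 norm
    of [decay m t]. *)
Definition decay_mass m t : R := (1 - expR (- (m * t))) / m.

Lemma int_decay m T t : m != 0 -> 0 <= t <= T ->
  \int[leb]_(s in `]0, T[) decay m t s = decay_mass m t.
Proof.
move=> m0 /andP[t0 tT]; rewrite Rintegral_indicM; last first.
  by move=> s/=; rewrite !in_itv/= => /andP[-> /lt_le_trans->].
by rewrite int_expR_decay// subr0 subrr mulr0 oppr0 expR0.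
Qed.

Lemma decay_mass_ge0 m t : 0 < m -> 0 <= t -> 0 <= decay_mass m t.
Proof.
move=> m0 t0; apply: divr_ge0; last exact: ltW.
by rewrite subr_ge0 -[leRHS]expR0 ler_expR oppr_le0 mulr_ge0// ltW.
Qed.

Lemma decay_mass_le m t : 0 < m -> decay_mass m t <= m^-1.
Proof.
move=> m0; rewrite /decay_mass ler_pdivrMr// mulVf ?gt_eqF//.
Qed.

End exponential_modes.

(** * Time slabs and the projection onto functions constant on each slab *)

Section slabs.
Context {R : realType}.
Variables (T : R) (N : nat).
Hypotheses (T_gt0 : 0 < T) (N_gt0 : (0 < N)%N).
Local Notation leb := (@lebesgue_measure R).
Local Notation dt := (dt T N).
Implicit Types (m t s : R) (n k : nat) (b : nat -> R).

Lemma dt_gt0 : 0 < dt.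
Proof. by rewrite /Defs.dt divr_gt0// ltr0n. Qed.

Lemma natr_dt : N%:R * dt = T.
Proof. by rewrite /Defs.dt mulrC divfK// pnatr_eq0 -lt0n. Qed.

(* Slab n.+1, cut at time t, runs from stop_grid n t to stop_grid n.+1 t. *)
Definition stop_grid n t : R := Num.min (n%:R * dt) t.

Lemma stop_grid_mono n t : stop_grid n t <= stop_grid n.+1 t.
Proof.
rewrite /stop_grid le_min; apply/andP; split; last by rewrite ge_min lexx orbT.
by rewrite ge_min; apply/orP; left; rewrite ler_wpM2r ?ler_nat// ltW// dt_gt0.
Qed.

Lemma lebesgue_time_slab n : (leb (time_slab T N n.+1) = dt%:E)%E.
Proof.
rewrite /time_slab lebesgue_measure_itv/= lte_fin ltr_pM2r ?dt_gt0// ltr_nat ltnSn.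
by rewrite -EFinB/= -mulrBl -natr1 addrAC subrr add0r mul1r.
Qed.

Lemma slab_sub n : (n < N)%N -> time_slab T N n.+1 `<=` `]0, T[.
Proof.
move=> nN s; rewrite /time_slab/= !in_itv/= => /andP[a b]; apply/andP; split.
  by apply: le_lt_trans a; rewrite mulr_ge0// ltW// dt_gt0.
by apply: (lt_le_trans b); rewrite -[leRHS]natr_dt ler_wpM2r ?ler_nat// ltW// dt_gt0.
Qed.

Lemma slab_stopped n t : 0 <= t ->
  time_slab T N n.+1 `&` `]0, t[ = `]stop_grid n t, stop_grid n.+1 t[%classic.
Proof.
move=> t0; have d0 := ltW dt_gt0; apply/seteqP; split => s; rewrite /time_slab/= !in_itv/=.
  by move=> [/andP[a b] /andP[s0 st]]; rewrite /stop_grid gt_min a/= lt_min b st.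
rewrite /stop_grid gt_min lt_min => /andP[a /andP[b st]].
have {}a : n%:R * dt < s.
  by case/orP : a => // ts; move: (lt_trans ts st); rewrite ltxx.
by rewrite a b st (le_lt_trans _ a)// mulr_ge0.
Qed.

(** The integral of [decay m t] over slab [n.+1]. Beyond t both stopped endpoints equal t and the
    formula gives 0, so it serves every slab. *)
Definition slab_mass m n t : R :=
  (expR (- (m * (t - stop_grid n.+1 t))) - expR (- (m * (t - stop_grid n t)))) / m.

(** The form that arises from Duhamel's formula for [uhat]; [int_slab_decay] is the one that arises
    from inner products on (0, T). Their agreement makes the coefficients of [uhat] those of the
    projection. *)
Lemma int_slab_expR m n t : m != 0 -> 0 <= t ->
  \int[leb]_(s in `]0, t[) (\1_(time_slab T N n.+1) s * expR (- (m * (t - s)))) =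
  slab_mass m n t.
Proof.
move=> m0 t0; rewrite /slab_mass -int_expR_decay// ?stop_grid_mono// -slab_stopped// setIC.
rewrite Rintegral_mkcondr; apply: eq_Rintegral => s _.
by rewrite patchE indicE; case: ifP => _; rewrite ?mul1r ?mul0r.
Qed.

Lemma int_slab_decay m n t : m != 0 -> 0 <= t -> (n < N)%N ->
  \int[leb]_(s in `]0, T[) (\1_(time_slab T N n.+1) s * decay m t s) = slab_mass m n t.
Proof.
move=> m0 t0 nN; rewrite Rintegral_indicM; last exact: slab_sub.
rewrite /slab_mass -int_expR_decay// ?stop_grid_mono// -slab_stopped// Rintegral_mkcondr.
apply: eq_Rintegral => s _.
by rewrite patchE /decay indicE; case: ifP => _; rewrite ?mul1r ?mul0r.
Qed.

Definition step b s : R := \sum_(0 <= n < N) \1_(time_slab T N n.+1) s * b n.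

Lemma indic_slabM n k s :
  \1_(time_slab T N n.+1) s * \1_(time_slab T N k.+1) s =
  (n == k)%:R * \1_(time_slab T N n.+1) s :> R.
Proof.
transitivity (\1_(time_slab T N n.+1 `&` time_slab T N k.+1) s : R).
  by rewrite indicI.
have [->|nk] := eqVneq n k; first by rewrite setIid mul1r.
rewrite mul0r (_ : _ `&` _ = set0) ?indic0//; apply/seteqP; split => // r; rewrite /time_slab/=.
rewrite !in_itv/= => -[/andP[a b] /andP[c d]].
have := lt_trans a d; have := lt_trans c b.
rewrite !ltr_pM2r ?dt_gt0// !ltr_nat !ltnS => kn nk'.
by move: nk; rewrite eqn_leq kn nk'.
Qed.

Lemma step_sqr b s : step b s ^+ 2 = step (fun n => b n ^+ 2) s.
Proof.
rewrite expr2 /step big_distrlr/=; apply: eq_big_nat => n /andP[_ nN].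
rewrite (bigD1_seq n)/= ?mem_index_iota ?iota_uniq// big1 ?addr0.
  by rewrite mulrACA indic_slabM eqxx mul1r expr2.
by move=> k kn; rewrite mulrACA indic_slabM eq_sym (negPf kn) !mul0r.
Qed.

Lemma measurable_step b A : measurable_fun A (step b).
Proof.
apply: measurable_funTS; apply: measurable_sum => n.
by apply: measurable_funM => //; apply: measurable_indic; exact: measurable_itv.
Qed.

(** The square is expanded slab by slab. The values [b] are left free in order to cover both the
    slab means, for the modes kept in the load, and 0, for the others. *)
Lemma int_sqr_decay_step m b t : 0 < m -> 0 <= t <= T ->
  \int[leb]_(s in `]0, T[) ((decay m t s - step b s) ^+ 2) =
  decay_mass (2 * m) t +
  \sum_(0 <= n < N) (b n ^+ 2 * dt - 2 * b n * slab_mass m n t).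
Proof.
move=> m0 tT; have [t0 _] := andP tT.
have mT : measurable (`]0, T[%classic : set R) by exact: measurable_itv.
have islab n (c : R) : leb.-integrable `]0, T[ (EFin \o (fun s => \1_(time_slab T N n.+1) s * c)).
  apply: (@bounded_integrable_oo _ _ _ _ `|c|).
    by apply: measurable_funM => //; apply: measurable_indic; exact: measurable_itv.
  by move=> s _; rewrite indicE; case: (s \in _); rewrite ?mul1r// mul0r normr0.
have idec n (c : R) : leb.-integrable `]0, T[
    (EFin \o (fun s => c * (\1_(time_slab T N n.+1) s * decay m t s))).
  apply: (@bounded_integrable_oo _ _ _ _ `|c|).
    apply: measurable_funM => //; apply: measurable_funM; last exact: measurable_decay.
    by apply: measurable_indic; exact: measurable_itv.
  move=> s _; rewrite normrM ler_piMr// normrM mulr_ile1//.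
    by rewrite indicE normr_nat; case: (_ \in _).
  by rewrite ger0_norm ?decay_ge0// decay_le1// ltW.
have E s : (decay m t s - step b s) ^+ 2 = decay (2 * m) t s +
   \sum_(0 <= n < N) (\1_(time_slab T N n.+1) s * b n ^+ 2
     - 2 * b n * (\1_(time_slab T N n.+1) s * decay m t s)).
  rewrite sqrrB decay_sqr step_sqr -addrA; congr (_ + _).
  rewrite /step -mulr_natl !mulr_sumr -sumrN -big_split/=; apply: eq_bigr => n _.
  by ring.
under eq_Rintegral do rewrite E.
have isl n : leb.-integrable `]0, T[ (EFin \o (fun s => \1_(time_slab T N n.+1) s * b n ^+ 2
     - 2 * b n * (\1_(time_slab T N n.+1) s * decay m t s))).
  exact: integrableB_EFin.
rewrite RintegralD//; first last.
- exact: integrable_sum_EFin.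
- apply: (@bounded_integrable_oo _ _ _ _ 1); first exact: measurable_decay.
  by move=> s _; rewrite ger0_norm ?decay_ge0// decay_le1// mulr_ge0 ?ltW.
rewrite int_decay ?mulf_neq0 ?gt_eqF//; congr (_ + _).
rewrite Rintegral_sum//; apply: eq_big_nat => n /andP[_ nN].
rewrite RintegralB// RintegralZl//; last first.
  by apply: eq_integrable (idec n 1) => // s _ /=; rewrite mul1r.
rewrite int_slab_decay ?gt_eqF//; congr (_ - _).
rewrite Rintegral_indicM; last exact: slab_sub.
rewrite Rintegral_cst; last exact: measurable_itv.
by rewrite [X in fine X](lebesgue_time_slab n).
Qed.


(** Pythagoras: the squared norm of f minus that of its projection, whose value on a slab is
    [slab_mass / dt]. *)
Definition proj_err m t : R :=
  decay_mass (2 * m) t - \sum_(0 <= n < N) slab_mass m n t ^+ 2 / dt.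

Lemma int_sqr_decay_proj m t : 0 < m -> 0 <= t <= T ->
  \int[leb]_(s in `]0, T[) ((decay m t s - step (fun n => slab_mass m n t / dt) s) ^+ 2) =
  proj_err m t.
Proof.
move=> m0 tT; rewrite int_sqr_decay_step//; congr (_ + _); rewrite -sumrN.
apply: eq_bigr => n _; have : dt != 0 by rewrite gt_eqF ?dt_gt0.
by move=> d0; field.
Qed.

(** Here p and q stand for the values of f at the left and right ends of a slab that ends by t, so
    the left side is the integral of f^2 minus (integral of f)^2 / dt on that slab. Of the
    exponential only q = p e^{m dt} >= p (1 + m dt) is retained. *)
Lemma slab_err_le m q p : 0 < m -> 0 <= p -> q <= 1 -> p * (1 + m * dt) <= q ->
  (q ^+ 2 - p ^+ 2) / (2 * m) - ((q - p) / m) ^+ 2 / dt <= (q - p) * dt.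
Proof.
move=> m0 p0 q1 pq; have d0 := dt_gt0; set h := dt in d0 pq *.
have x0 : 0 < m * h by rewrite mulr_gt0.
have q0 : 0 <= q by apply: le_trans pq; rewrite mulr_ge0// addr_ge0// ltW.
have pleq : p <= q.
  by apply: le_trans pq; rewrite mulrDr mulr1 lerDl mulr_ge0// ltW.
have -> : (q ^+ 2 - p ^+ 2) / (2 * m) - ((q - p) / m) ^+ 2 / h =
    (q - p) * (((q + p) * (m * h) - 2 * (q - p)) / (2 * m ^+ 2 * h)).
  by field; rewrite !gt_eqF.
rewrite ler_wpM2l ?subr_ge0// ler_pdivrMr; last by rewrite mulr_gt0// mulr_gt0// exprn_gt0.
have -> : h * (2 * m ^+ 2 * h) = 2 * (m * h) ^+ 2 by ring.
set x := m * h in x0 pq *.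
(* The claim is (q + p) x - 2 (q - p) <= 2 x^2. Inserting p <= q / (1 + x) bounds the left side by q
   x^2 / (1 + x), at most x^2. *)
nra.
Qed.

Lemma sum_stopped (f : R -> R) t : 0 <= t <= T ->
  \sum_(0 <= n < N) (f (stop_grid n.+1 t) - f (stop_grid n t)) = f t - f 0.
Proof.
move=> /andP[t0 tT]; rewrite telescope_sumr//; congr (f _ - f _).
  by rewrite /stop_grid natr_dt min_r.
by rewrite /stop_grid mul0r min_l.
Qed.

(** A slab that ends by t costs at most dt times the rise of f over it; the slab that contains t
    costs at most dt; slabs beyond t cost nothing. The rises telescope to 1 - e^{-m t} and the jumps
    of [past] to at most 1, whence the factor 2. *)
Lemma proj_err_le_dt m t : 0 < m -> 0 <= t <= T -> proj_err m t <= 2 * dt.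
Proof.
move=> m0 tT; have [t0 _] := andP tT; have d0 := dt_gt0.
pose e s := expR (- (m * (t - s))).
(* The slab that contains t costs at most dt, recorded by the jump of [past]. *)
pose past n : R := (t < n%:R * dt)%R%:R.
have -> : proj_err m t = \sum_(0 <= n < N)
    ((e (stop_grid n.+1 t) ^+ 2 - e (stop_grid n t) ^+ 2) / (2 * m)
     - ((e (stop_grid n.+1 t) - e (stop_grid n t)) / m) ^+ 2 / dt).
  rewrite [RHS]sumrB; congr (_ - _).
  rewrite -mulr_suml (sum_stopped (fun s => e s ^+ 2) tT) /decay_mass /e.
  rewrite -!expRM_natl subrr mulr0 oppr0 mulr0 expR0 addr0; congr ((_ - expR _) / _).
  by ring.
apply: (@le_trans _ _ (\sum_(0 <= n < N)
    ((e (stop_grid n.+1 t) - e (stop_grid n t)) * dt + (past n.+1 - past n) * dt))).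
  apply: ler_sum => n _; rewrite /past /stop_grid.
  have gS : n.+1%:R * dt = n%:R * dt + dt by rewrite -natr1 mulrDl mul1r.
  have [tn|nt] := ltP t (n%:R * dt).
    have tn1 : t < n.+1%:R * dt by rewrite gS ltr_wpDr// ltW.
    by rewrite tn1 (min_r (ltW tn1)) !subrr !mul0r expr0n/= mul0r subr0 addr0.
  have en : e (n%:R * dt) <= 1.
    by rewrite /e -[leRHS]expR0 ler_expR oppr_le0 mulr_ge0 ?subr_ge0// ltW.
  have [tn1|n1t] := ltP t (n.+1%:R * dt).
    (* This slab contains t. The projection term is dropped, and the integral of f^2 is at most t -
       n dt, hence at most dt, by 1 + x <= e^x. *)
    rewrite subr0 mul1r.
    have -> : e t = 1 by rewrite /e subrr mulr0 oppr0 expR0.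
    rewrite -[leLHS]add0r; apply: lerD; first by rewrite mulr_ge0 ?subr_ge0// ltW.
    apply: (@le_trans _ _ ((1 ^+ 2 - e (n%:R * dt) ^+ 2) / (2 * m))).
      by rewrite gerBl divr_ge0 ?sqr_ge0// ltW.
    rewrite ler_pdivrMr ?mulr_gt0// expr1n /e -expRM_natl.
    have := expR_ge1Dx (2 * - (m * (t - n%:R * dt))).
    have : t - n%:R * dt <= dt by rewrite lerBlDl -gS ltW.
    by nra.
  rewrite subrr mul0r addr0; apply: slab_err_le => //.
  - exact: expR_ge0.
  - by rewrite /e -[leRHS]expR0 ler_expR oppr_le0 mulr_ge0 ?subr_ge0// ltW.
  - have -> : e (n.+1%:R * dt) = e (n%:R * dt) * expR (m * dt).
      by rewrite /e -expRD gS; congr expR; ring.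
    by rewrite ler_wpM2l ?expR_ge0// expR_ge1Dx.
rewrite big_split/= -!mulr_suml sum_stopped// telescope_sumr//.
rewrite -mulrDl ler_wpM2r ?(ltW d0)//; rewrite -[leRHS]/(1 + 1); apply: lerD.
  by rewrite /e subrr mulr0 oppr0 expR0 lerBlDr lerDl expR_ge0.
by rewrite /past mul0r (le_gtF t0) subr0; case: (_ < _).
Qed.

Lemma proj_err_le_inv m t : 0 < m -> proj_err m t <= (2 * m)^-1.
Proof.
move=> m0; apply: (@le_trans _ _ (decay_mass (2 * m) t)).
  rewrite gerBl; apply: sumr_ge0 => n _.
  by rewrite divr_ge0 ?sqr_ge0// ltW// dt_gt0.
by rewrite decay_mass_le// mulr_gt0.
Qed.

Lemma continuous_decay_mass m : continuous (decay_mass m).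
Proof.
have ce : continuous (fun t => expR (- (m * t))).
  rewrite (_ : (fun t => _) = (fun t => expR (- m * t + 0))); first exact: continuous_expR_affine.
  by apply/funext => r; rewrite addr0 mulNr.
by move=> t; apply: cvgM; [apply: cvgB; [exact: cvg_cst|exact: ce]|exact: cvg_cst].
Qed.

(** The minimum in [stop_grid] keeps the formula continuous when t crosses a grid point. *)
Lemma continuous_slab_mass m n : continuous (slab_mass m n).
Proof.
have cg k : continuous (stop_grid k).
  move=> t; apply: (@continuous_min _ _ (fun=> k%:R * dt) id t).
    exact: cvg_cst.
  exact: cvg_id.
have ce k : continuous (fun t => expR (- (m * (t - stop_grid k t)))).
  move=> t; apply: (@continuous_comp _ _ _ (fun t => - (m * (t - stop_grid k t))) expR).
    apply: cvgN; apply: cvgM; first exact: cvg_cst.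
    by apply: cvgB; [exact: cvg_id|exact: cg].
  exact: continuous_expR.
move=> t; apply: cvgM; last exact: cvg_cst.
by apply: cvgB; exact: ce.
Qed.

Lemma continuous_proj_err m : continuous (proj_err m).
Proof.
move=> t; apply: cvgB; first exact: continuous_decay_mass.
apply: (@continuous_sum_seq _ _ _ (fun n t => slab_mass m n t ^+ 2 / dt)) => n {}t.
apply: cvgM; last exact: cvg_cst.
by apply: cvgM; exact: continuous_slab_mass.
Qed.

End slabs.
(** * Summation over the modes *)

Section series_estimates.
Context {R : realType}.
Implicit Types (u : nat -> R) (k n : nat).

Lemma limn_series_tail_le (f u : nat -> R) n : cvgn (series u) ->
  (forall k, `|f k| <= u k) ->
  `|limn (series f) - series f n| <= limn (series u) - series u n.
Proof.
move=> cu fu.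
have cf : cvgn (series f).
  by apply: normed_cvg; apply: series_le_cvg cu => k;
    [exact: normr_ge0|exact: le_trans (normr_ge0 _) (fu k)|exact: fu].
have c1 : (fun m => `|series f m - series f n|) @ \oo --> `|limn (series f) - series f n|.
  by apply: cvg_norm; apply: cvgB => //; exact: cvg_cst.
have c2 : (fun m => series u m - series u n) @ \oo --> limn (series u) - series u n.
  by apply: cvgB => //; exact: cvg_cst.
apply: (ler_cvg_to c1 c2); near=> m.
have nm : (n <= m)%N by near: m; exact: nbhs_infty_ge.
rewrite !sub_series_geq//; apply: le_trans (ler_norm_sum _ _ _) _.
exact: ler_sum.
Unshelve. all: by end_near. Qed.

(** Weierstrass test: the tails at x and y are controlled by the common tail of [u], which leaves
    partial sums of one fixed length n. Each of the three parts gets e / 3. *)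
Lemma continuous_within_limn_series (K : set R) (f : nat -> R -> R) u :
  cvgn (series u) -> (forall k, continuous (f k)) ->
  (forall k x, K x -> `|f k x| <= u k) ->
  {within K, continuous (fun x => limn (series (f ^~ x)))}.
Proof.
move=> cu cf fu; apply/subspace_continuousP => x Kx.
apply/cvgrPdist_le => e e0.
have e3 : 0 < e / 3 by rewrite divr_gt0.
have /cvgrPdist_le/(_ _ e3)[n _ nP] := cu.
have {nP} un : limn (series u) - series u n <= e / 3.
  by apply: le_trans (ler_norm _) _; apply: nP => /=; exact: leqnn.
have cS : continuous (fun y => series (f ^~ y) n).
  exact: (@continuous_sum_seq _ _ (index_iota 0 n) f).
rewrite near_withinE; near=> y => Ky.
have h1 := le_trans (limn_series_tail_le n cu (fun k => fu k x Kx)) un.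
have h2 := le_trans (limn_series_tail_le n cu (fun k => fu k y Ky)) un.
have h3 : `|series (f ^~ x) n - series (f ^~ y) n| <= e / 3.
  by near: y; have /cvgrPdist_le := cS x; exact.
have thirds (a b c d r : R) : `|a - b| <= r / 3 -> `|c - d| <= r / 3 ->
    `|b - d| <= r / 3 -> `|a - c| <= r.
  rewrite !ler_norml => /andP[a1 a2] /andP[b1 b2] /andP[c1 c2].
  by apply/andP; split; lra.
exact: thirds h1 h2 h3.
Unshelve. all: by end_near. Qed.

(* With y = k h, min(1, y^-4) <= 4 / (1 + y)^2, and the right side is dominated by
   the telescoping differences of h^-1 * y / (1 + y). *)
Lemma sum_min_quartic_le (h : R) n : 0 < h ->
  \sum_(0 <= k < n) Num.min (h ^+ 4) (k.+1%:R ^- 4) <= 4 * h ^+ 3.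
Proof.
move=> h0; pose phi k : R := k%:R * h / (1 + k%:R * h).
have p k : 0 < 1 + k%:R * h by rewrite ltr_pwDl// mulr_ge0// ltW.
apply: (@le_trans _ _ (\sum_(0 <= k < n) 4 * h ^+ 3 * (phi k.+1 - phi k))).
  apply: ler_sum => k _.
  apply: (@le_trans _ _ (4 * h ^+ 4 / (1 + k.+1%:R * h) ^+ 2)).
    rewrite ge_min.
    have y0 : 0 < k.+1%:R * h by rewrite mulr_gt0.
    (* For y <= 1 the entry h^4 of the minimum suffices, as (1 + y)^2 <= 4. For y > 1 the other
       entry is h^4 y^-4, and (1 + y)^2 <= 4 y^4 follows from 1 + y <= 2 y^2. *)
    have [y1|y1] := leP (k.+1%:R * h) 1; apply/orP; [left|right].
      rewrite ler_pdivlMr ?exprn_gt0// [leRHS]mulrC ler_wpM2l ?exprn_ge0 ?(ltW h0)//.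
      by nra.
    rewrite ler_pdivlMr ?exprn_gt0// mulrC ler_pdivrMr ?exprn_gt0//.
    have -> : 4 * h ^+ 4 * k.+1%:R ^+ 4 = 4 * (k.+1%:R * h) ^+ 4 by ring.
    set y := k.+1%:R * h in y0 y1 *.
    have y2 : y <= y ^+ 2 by rewrite expr2 ler_pMl// ltW.
    have : 1 + y <= 2 * y ^+ 2 by lra.
    have : 0 <= 1 + y by lra.
    by nra.
  have -> : phi k.+1 - phi k = h / ((1 + k.+1%:R * h) * (1 + k%:R * h)).
    rewrite /phi -natr1.
    field.
    by rewrite natr1 !gt_eqF.
  have -> : 4 * h ^+ 3 * (h / ((1 + k.+1%:R * h) * (1 + k%:R * h))) =
     4 * h ^+ 4 / ((1 + k.+1%:R * h) * (1 + k%:R * h)).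
    by rewrite mulrA; congr (_ / _); ring.
  rewrite ler_wpM2l ?mulr_ge0 ?exprn_ge0 ?(ltW h0)// lef_pV2 ?posrE ?exprn_gt0 ?mulr_gt0//.
  by rewrite expr2 ler_wpM2l ?(ltW (p _))// lerD2l ler_wpM2r ?ler_nat// ltW.
rewrite -mulr_sumr telescope_sumr// /phi mul0r mul0r subr0 ler_piMr//.
  by rewrite mulr_ge0// exprn_ge0// ltW.
by rewrite ler_pdivrMr// mul1r lerDr.
Qed.

(** A discrete integral comparison: (k + 1)^-4 <= k^-3 - (k + 1)^-3 for k > 0, and these differences
    telescope. *)
Lemma sum_inv_quartic_tail_le m n : (0 < m)%N ->
  \sum_(m <= k < n) (k.+1%:R ^- 4 : R) <= m%:R ^- 3.
Proof.
move=> m0; have [nm|mn] := leqP n m.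
  by rewrite big_geq// invr_ge0 exprn_ge0.
apply: (@le_trans _ _ (\sum_(m <= k < n) (- k.+1%:R ^- 3 - (- k%:R ^- 3)))).
  apply: ler_sum_nat => k /andP[mk _].
  have k0 : 0 < k%:R :> R by rewrite ltr0n (leq_trans m0).
  rewrite -natr1; set x := k%:R in k0 *.
  have x1 : 0 < x + 1 by lra.
  have -> : - (x + 1) ^- 3 - - x ^- 3 = (3 * x ^+ 2 + 3 * x + 1) * (x + 1) / (x ^+ 3 * (x + 1) ^+ 4).
    by field; rewrite !gt_eqF.
  rewrite ler_pdivlMr ?mulr_gt0 ?exprn_gt0// mulrCA mulVf ?mulr1; last by rewrite gt_eqF ?exprn_gt0.
  by nra.
rewrite telescope_sumr ?(ltnW mn)//.
by rewrite opprK addrC gerBl invr_ge0 exprn_ge0.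
Qed.

Lemma cvg_series_inv_quartic : cvgn (series (fun k => k.+1%:R ^- 4 : R)).
Proof.
apply: nondecreasing_is_cvgn.
  by apply: nondecreasing_series => k _ _; rewrite invr_ge0 exprn_ge0.
exists 2 => _ [n _ <-]; rewrite /series/=.
case: n => [|n]; first by rewrite big_geq.
rewrite big_ltn// expr1n invr1 -[leRHS]/(1 + 1) lerD2l.
by apply: (le_trans (@sum_inv_quartic_tail_le 1 n.+1 isT)); rewrite expr1n invr1.
Qed.

Definition eigval k : R := lambda k.+1 ^+ 4.

Lemma eigval_ge k : k.+1%:R ^+ 4 <= eigval k.
Proof.
rewrite /eigval /lambda lerXn2r ?nnegrE ?mulr_ge0 ?pi_ge0//.
by rewrite ler_peMr// (le_trans _ (pi_ge2 R))// ler1n.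
Qed.

Lemma eigval_gt0 k : 0 < eigval k.
Proof. by apply: lt_le_trans (eigval_ge k); rewrite exprn_gt0. Qed.

Lemma inv_eigval_le k : (2 * eigval k)^-1 <= k.+1%:R ^- 4.
Proof.
have e0 := eigval_gt0 k.
have x0 : 0 < k.+1%:R ^+ 4 :> R by rewrite exprn_gt0.
rewrite lef_pV2 ?posrE//; last by rewrite mulr_gt0.
by apply: le_trans (eigval_ge k) _; lra.
Qed.

End series_estimates.

(** * The error of each mode and the total error *)

Section mode_errors.
Context {R : realType}.
Variables (T : R) (M N : nat).
Hypotheses (T_gt0 : 0 < T) (M_gt0 : (0 < M)%N) (N_gt0 : (0 < N)%N).
Local Notation leb := (@lebesgue_measure R).
Local Notation dt := (dt T N).
Implicit Types (k n : nat) (t s : R).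

(* Value on slab n.+1 of the step function g_k that approximates the mode k. *)
Definition mode_coef k t n : R := (k < M)%N%:R * slab_mass T N (eigval k) n t / dt.

(** The closed form of err_{k+1} (see [int_sqr_mode]), in which it is bounded and seen to be
    continuous in t. For [k >= M] nothing is subtracted from f_{k+1}, and its full squared norm
    remains. *)
Definition mode_err k t : R :=
  if (k < M)%N then proj_err T N (eigval k) t else decay_mass (2 * eigval k) t.

Lemma int_sqr_mode k t : 0 <= t <= T ->
  \int[leb]_(s in `]0, T[) ((decay (eigval k) t s - step T N (mode_coef k t) s) ^+ 2) =
  mode_err k t.
Proof.
move=> tT; rewrite /mode_err /mode_coef; case: ifP => kM.
  rewrite -int_sqr_decay_proj// ?(eigval_gt0 k)//; apply: eq_Rintegral => s _.
  by congr ((_ - step _ _ _ _) ^+ 2); apply/funext => n; rewrite mul1r.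
rewrite int_sqr_decay_step ?(eigval_gt0 k)// big1 ?addr0// => n _.
by rewrite !mul0r expr0n/= mul0r mulr0 mul0r subr0.
Qed.

(** The closed form is a difference whose sign is hidden; the integral of a square shows it. *)
Lemma mode_err_ge0 k t : 0 <= t <= T -> 0 <= mode_err k t.
Proof.
by move=> tT; rewrite -int_sqr_mode//; apply: Rintegral_ge0 => s _; exact: sqr_ge0.
Qed.

Lemma mode_err_le k t : mode_err k t <= k.+1%:R ^- 4.
Proof.
apply: le_trans (inv_eigval_le k); rewrite /mode_err; case: ifP => _.
  by apply: proj_err_le_inv; rewrite ?(eigval_gt0 k).
by apply: decay_mass_le; rewrite mulr_gt0// eigval_gt0.
Qed.

Lemma norm_mode_err_le k t : 0 <= t <= T -> `|mode_err k t| <= k.+1%:R ^- 4.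
Proof. by move=> tT; rewrite ger0_norm ?mode_err_ge0// mode_err_le. Qed.

Definition total_err t : R := limn (series (mode_err ^~ t)).

Lemma is_cvg_total_err t : 0 <= t <= T -> cvgn (series (mode_err ^~ t)).
Proof.
move=> tT; apply: series_le_cvg (@cvg_series_inv_quartic R) => k.
- exact: mode_err_ge0.
- by rewrite invr_ge0 exprn_ge0.
- exact: mode_err_le.
Qed.

Lemma total_err_ge0 t : 0 <= t <= T -> 0 <= total_err t.
Proof.
move=> tT; apply: limr_ge; first exact: is_cvg_total_err.
by apply: nearW => n; apply: sumr_ge0 => k _; exact: mode_err_ge0.
Qed.

Lemma continuous_total_err : {within `[0, T], continuous total_err}.
Proof.
apply: (continuous_within_limn_series (@cvg_series_inv_quartic R)).
  move=> k; rewrite /mode_err; case: (k < M)%N; first exact: continuous_proj_err.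
  exact: continuous_decay_mass.
by move=> k t/=; rewrite in_itv/=; exact: norm_mode_err_le.
Qed.

Lemma total_err_le t : 0 <= t <= T ->
  total_err t <= 8 * dt `^ (3 / 4) + M%:R ^- 3.
Proof.
move=> tT; apply: limr_le; first exact: is_cvg_total_err.
apply: nearW => n; rewrite /series/=.
have d0 := dt_gt0 T_gt0 N_gt0.
(* The bounds dt and k^-4 cross near k = 1 / h. At this h, [sum_min_quartic_le] yields 4 dt^{3/4},
   and the factor 2 of [proj_err_le_dt] makes it 8. *)
pose h := dt `^ (1 / 4).
have h0 : 0 < h by exact: powR_gt0.
have hX k : h ^+ k = dt `^ (k%:R / 4).
  by rewrite -powR_mulrn ?powR_ge0// -powRrM; congr (_ `^ _); field.
have h4 : h ^+ 4 = dt by rewrite hX divff// powRr1// ltW.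
(* The partial sum is lengthened to [M + n] terms so that it can be cut at [M] for every n. *)
apply: (@le_trans _ _ (\sum_(0 <= k < M + n) mode_err k t)).
  rewrite [leRHS](@big_cat_nat _ _ _ n)//= ?leq_addl// lerDl.
  by apply: sumr_ge0 => k _; exact: mode_err_ge0.
rewrite (@big_cat_nat _ _ _ M)//= ?leq_addr//; apply: lerD.
  apply: (@le_trans _ _ (\sum_(0 <= k < M) 2 * Num.min (h ^+ 4) (k.+1%:R ^- 4))).
    apply: ler_sum_nat => k /andP[_ kM].
    have [_|_] := leP (h ^+ 4).
      by rewrite h4 /mode_err kM; apply: proj_err_le_dt; rewrite ?(eigval_gt0 k).
    apply: le_trans (mode_err_le k t) _.
    by rewrite ler_peMl ?ler1n// invr_ge0 exprn_ge0.
  rewrite -mulr_sumr -hX.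
  have := sum_min_quartic_le M h0; lra.
apply: le_trans (@sum_inv_quartic_tail_le R M (M + n) M_gt0).
by apply: ler_sum => k _; exact: mode_err_le.
Qed.

End mode_errors.
(** * Kernels on the cylinder and their L^2 norms *)

Section tonelli_rectangle.
Local Open Scope ereal_scope.
Context {d1 d2 : measure_display} {T1 : measurableType d1} {T2 : measurableType d2}.
Context {R : realType}.
Variables (m1 : {sigma_finite_measure set T1 -> \bar R}).
Variables (m2 : {sigma_finite_measure set T2 -> \bar R}).
Variables (A : set T1) (B : set T2) (f : T1 * T2 -> \bar R).
Hypotheses (mA : measurable A) (mB : measurable B).
Hypotheses (mf : measurable_fun (A `*` B) f) (f0 : forall z, 0 <= f z).

Let g := f \_ (A `*` B).

Let mg : measurable_fun setT g.
Proof. by apply/(measurable_restrictT _ _).1 => //; exact: measurableX. Qed.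

Let g0 z : 0 <= g z.
Proof. by rewrite /g patchE; case: ifP. Qed.

Let restrict_rect x y : g (x, y) = ((fun x' => ((fun y' => f (x', y')) \_ B) y) \_ A) x.
Proof.
by rewrite /g !patchE in_setX/=; case: (x \in A); case: (y \in B).
Qed.

(** Extension by 0 reduces this to Tonelli on the whole product. It splits the norm on the cylinder
    into s and y; [integral_rectangle_swap] exchanges the expectation with the integral over x. *)
Lemma integral_rectangle :
  \int[m1 \x m2]_(z in A `*` B) f z = \int[m1]_(x in A) \int[m2]_(y in B) f (x, y).
Proof.
rewrite integral_mkcond -/g fubini_tonelli1// [RHS]integral_mkcond; apply: eq_integral => x _.
rewrite /fubini_F patchE; case: ifPn => xA.
  by rewrite [RHS]integral_mkcond; apply: eq_integral => y _; rewrite restrict_rect patchE xA.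
by rewrite integral0_eq// => y _; rewrite restrict_rect patchE (negPf xA).
Qed.

Lemma integral_rectangle_swap :
  \int[m1]_(x in A) \int[m2]_(y in B) f (x, y) =
  \int[m2]_(y in B) \int[m1]_(x in A) f (x, y).
Proof.
transitivity (\int[m1]_x \int[m2]_y g (x, y)).
  rewrite integral_mkcond; apply: eq_integral => x _; rewrite patchE; case: ifPn => xA.
    by rewrite integral_mkcond; apply: eq_integral => y _; rewrite restrict_rect [RHS]patchE xA.
  by rewrite integral0_eq// => y _; rewrite restrict_rect patchE (negPf xA).
rewrite (@fubini_tonelli _ _ _ _ _ m1 m2 g)// [RHS]integral_mkcond; apply: eq_integral => y _.
rewrite patchE; case: ifPn => yB.
  rewrite [RHS]integral_mkcond; apply: eq_integral => x _.
  by rewrite restrict_rect !patchE; case: ifP => //; rewrite yB.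
by rewrite integral0_eq// => x _; rewrite restrict_rect !patchE; case: ifP => //; rewrite (negPf yB).
Qed.

End tonelli_rectangle.

Lemma nneseries_EFin_limn {R : realType} (x : nat -> R) : cvgn (series x) ->
  (\sum_(k <oo) (x k)%:E = (limn (series x))%:E)%E.
Proof.
move=> cx; apply/cvg_lim => //.
rewrite (_ : (fun n => _) = EFin \o series x); last first.
  by apply/funext => n /=; rewrite sumEFin.
by apply: cvg_EFin => //; exact: nearW.
Qed.

Section sine_kernels.
Context {R : realType}.
Variable T : R.
Local Notation leb := (@lebesgue_measure R).
Local Notation D := (@domD R).
Variable a : nat -> R -> R.
Hypothesis ma : forall k, measurable_fun setT (a k).
Hypothesis sa : forall s, summable_seq (a ^~ s).

Lemma measurable_sine_kernel A :
  measurable_fun A (fun z : R * R => sine_series (a ^~ z.1) z.2).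
Proof.
apply: measurable_funTS.
apply: (@measurable_fun_cvg _ _ _ _ (fun n z => series (fun k => a k z.1 * eps k.+1 z.2) n)).
  move=> n; apply: measurable_sum => k; apply: measurable_funM.
    exact: measurableT_comp (ma k) measurable_fst.
  exact: measurableT_comp (@measurable_eps R k.+1 setT) measurable_snd.
by move=> z _; exact: cvg_sine_series.
Qed.

(** Parseval in y at each fixed s, then the exchange of sum and integral over s for nonnegative
    terms. Summability of the coefficients is asked only pointwise in s. *)
Lemma sqnorm_sine_kernel :
  (sqnorm_cylinder T (fun z => sine_series (a ^~ z.1) z.2) =
   \sum_(k <oo) \int[leb]_(s in `]0%R, T[) ((a k s) ^+ 2)%:E)%E.
Proof.
rewrite /sqnorm_cylinder /cylinder integral_rectangle//; first last.
- by move=> z; rewrite lee_fin sqr_ge0.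
- by apply/measurable_EFinP; apply: measurable_funX; exact: measurable_sine_kernel.
- exact: measurable_itv.
rewrite -integral_nneseries//; first last.
- by move=> k s _; rewrite lee_fin sqr_ge0.
- by move=> k; apply/measurable_EFinP; apply: measurable_funX; apply: measurable_funTS; exact: ma.
apply: eq_integral => s _ /=.
have sas : summable_seq (a ^~ s) by exact: sa.
have c := sine_series_parseval sas.
rewrite nneseries_EFin_limn; last by apply/cvg_ex; eexists; exact: c.
rewrite (cvg_lim (@Rhausdorff R) c) /Rintegral fineK//.
apply: integrable_fin_num; first exact: measurable_itv.
apply: (@bounded_integrable_oo _ _ _ _ ((2 * limn (series (fun k => `|a k s|))) ^+ 2)).
  by apply: measurable_funX; exact: measurable_sine_series.
by move=> y _; rewrite normrX lerXn2r ?nnegrE ?norm_sine_series_le// (le_trans _ (norm_sine_series_le 0 sas)).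
Qed.

End sine_kernels.

(** * The kernel of the exact solution *)

Section heat_kernels.
Context {R : realType}.
Local Notation leb := (@lebesgue_measure R).
Local Notation D := (@domD R).
Implicit Types (t s x y r : R) (k n : nat).

Lemma summable_seq_mul_eps (a : nat -> R) x : summable_seq a ->
  summable_seq (fun k => a k * eps k.+1 x).
Proof.
move=> sa; apply: (@summable_seq_le _ _ (fun k => 2 * `|a k|)).
  by move=> k; rewrite normrM mulrC ler_wpM2r// norm_eps_le.
by apply/cvg_ex; eexists; exact: cvg_series_mull sa.
Qed.

(** e^{-x} <= 1 / x gives the majorant r^-1 (k + 1)^-4, which blows up as r tends to 0. *)
Lemma summable_expR_eigval r : 0 < r ->
  summable_seq (fun k => expR (- (eigval k * r))).
Proof.
move=> r0; apply: (@summable_seq_le _ _ (fun k => r^-1 * k.+1%:R ^- 4)).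
  move=> k; rewrite ger0_norm ?expR_ge0// expRN -invfM.
  have x0 : 0 < r * k.+1%:R ^+ 4 by rewrite mulr_gt0// exprn_gt0.
  rewrite lef_pV2 ?posrE ?expR_gt0//.
  apply: (@le_trans _ _ (eigval k * r)); last first.
    by apply: le_trans (expR_ge1Dx _); rewrite lerDr.
  by rewrite mulrC ler_wpM2r ?eigval_ge// ltW.
by apply/cvg_ex; eexists; exact: cvg_series_mull (@cvg_series_inv_quartic R).
Qed.

Lemma summable_decay t s : summable_seq (fun k => decay (eigval k) t s).
Proof.
rewrite /decay indicE; case: (boolP (s \in _)) => [|_]; last first.
  by apply: (@summable_seq_finite _ _ 0) => k _; rewrite mul0r.
rewrite inE/= in_itv/= => /andP[_ st].
by under eq_fun do rewrite mul1r; apply: summable_expR_eigval; rewrite subr_gt0.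
Qed.

Lemma G_sine_series r x y :
  G r x y = sine_series (fun k => expR (- (eigval k * r)) * eps k.+1 x) y.
Proof. by congr (limn _); apply/funext => n; rewrite /series/= big_add1. Qed.

(** Off (0, t) both sides vanish, whatever value [limn] assigns to a divergent series in [G]. *)
Lemma heat_kernelE t x :
  (fun z : R * R => \1_(`]0, t[) z.1 * G (t - z.1) x z.2) =
  (fun z => sine_series (fun k => decay (eigval k) t z.1 * eps k.+1 x) z.2).
Proof.
apply/funext => z; rewrite G_sine_series /decay indicE.
case: (z.1 \in _); first by under [in RHS]eq_fun do rewrite mul1r; rewrite mul1r.
rewrite mul0r (@sine_series_finite _ _ 0) ?big_geq// => k _.
by rewrite !mul0r.
Qed.

(** Applied to the heat kernel, to see that its norm is finite, and to the error kernel, to compute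
    its norm. The bounds [B k] serve integrability alone and may grow with k. *)
Lemma sqnorm_mode_kernel T (h : nat -> R -> R) (B e : nat -> R) x :
  (forall k, measurable_fun setT (h k)) -> (forall s, summable_seq (h ^~ s)) ->
  (forall k s, `|h k s| <= B k) ->
  (forall k, \int[leb]_(s in `]0, T[) (h k s ^+ 2) = e k) ->
  (sqnorm_cylinder T (fun z => sine_series (fun k => (h k z.1 * eps k.+1 x)%R) z.2) =
   \sum_(k <oo) (eps k.+1 x ^+ 2 * e k)%:E)%E.
Proof.
move=> mh sh hB he.
rewrite (@sqnorm_sine_kernel _ _ (fun k s => h k s * eps k.+1 x)); first last.
- by move=> s; exact: summable_seq_mul_eps.
- by move=> k; apply: measurable_funM.
apply: eq_eseriesr => k _.
have ih : leb.-integrable `]0, T[ (EFin \o (fun s => h k s ^+ 2)).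
  apply: (@bounded_integrable_oo _ _ _ _ (B k ^+ 2)).
    by apply: measurable_funX; apply: measurable_funTS; exact: mh.
  move=> s _; rewrite normrX lerXn2r// nnegrE//.
  by apply: le_trans (hB k 0); exact: normr_ge0.
have mT : measurable (`]0, T[%classic : set R) by exact: measurable_itv.
rewrite -he -RintegralZl// /Rintegral fineK; last first.
  apply: integrable_fin_num => //.
  apply: (@bounded_integrable_oo _ _ _ _ (eps k.+1 x ^+ 2 * B k ^+ 2)).
    by apply: measurable_funM => //; apply: measurable_funX; apply: measurable_funTS; exact: mh.
  move=> s _; rewrite normrM ger0_norm ?sqr_ge0// ler_wpM2l ?sqr_ge0//.
  rewrite normrX lerXn2r// nnegrE//.
  by apply: le_trans (hB k 0); exact: normr_ge0.
by apply: eq_integral => s _; rewrite exprMn mulrC.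
Qed.

Lemma int_eps_sqr k : (\int[leb]_(x in D) (eps k.+1 x ^+ 2)%:E = 1)%E.
Proof.
have mD : measurable D by exact: measurable_itv.
rewrite -[LHS]fineK.
  by congr EFin; rewrite -[RHS]/(true%:R) -(eqxx k) -int_eps_eps.
apply: integrable_fin_num => //.
apply: (@bounded_integrable_oo _ _ _ _ (2 * 2)).
  by apply: measurable_funM; exact: measurable_eps.
by move=> x _; rewrite normrM ler_pM ?norm_eps_le.
Qed.

End heat_kernels.

(** * The approximate solution as a finite combination of noise coefficients *)

Section approximate_load.
Context {R : realType}.
Variables (T : R) (M N : nat).
Hypotheses (T_gt0 : 0 < T) (N_gt0 : (0 < N)%N).
Local Notation leb := (@lebesgue_measure R).
Local Notation D := (@domD R).
Local Notation dt := (dt T N).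
Implicit Types (t s x y : R) (k n i : nat).

(** Integration in y pairs the series of [G], absolutely convergent as t - s > 0, with the finitely
    many basis functions of the load, and each pairing selects one coefficient. *)
Lemma int_G_load (r : nat -> nat -> R) t s x : 0 < t - s ->
  \int[leb]_(y in D) (G (t - s) x y *
    \sum_(1 <= n < N.+1) \1_(time_slab T N n) s *
      (dt^-1 * \sum_(1 <= i < M.+1) r i n * eps i y)) =
  \sum_(0 <= n < N) \sum_(0 <= i < M) r i.+1 n.+1 * (dt^-1 * eps i.+1 x) *
    (\1_(time_slab T N n.+1) s * expR (- (eigval i * (t - s)))).
Proof.
move=> ts; set A := fun k => expR (- (eigval k * (t - s))) * eps k.+1 x.
have sA : summable_seq A.
  by apply: summable_seq_mul_eps; exact: summable_expR_eigval.
have mD : measurable D by exact: measurable_itv.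
have iA (c : R) i : leb.-integrable D (EFin \o (fun y => c * (sine_series A y * eps i.+1 y))).
  apply: (@bounded_integrable_oo _ _ _ _ (`|c| * (2 * limn (series (fun k => `|A k|)) * 2))).
    apply: measurable_funM => //; apply: measurable_funM; last exact: measurable_eps.
    exact: measurable_sine_series.
  move=> y _; rewrite normrM ler_wpM2l// normrM ler_pM// ?norm_eps_le//.
  exact: norm_sine_series_le.
transitivity (\int[leb]_(y in D) \sum_(0 <= n < N) \sum_(0 <= i < M)
    (\1_(time_slab T N n.+1) s * dt^-1 * r i.+1 n.+1) * (sine_series A y * eps i.+1 y)).
  apply: eq_Rintegral => y _; rewrite G_sine_series -/A mulr_sumr big_add1/=.
  apply: eq_bigr => n _; rewrite big_add1/= !mulr_sumr; apply: eq_bigr => i _.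
  by ring.
rewrite Rintegral_sum//; last by move=> n; apply: integrable_sum_EFin.
apply: eq_bigr => n _; rewrite Rintegral_sum//; apply: eq_bigr => i _.
rewrite RintegralZl//; last first.
  by apply: eq_integrable (iA 1 i) => // y _ /=; rewrite mul1r.
by rewrite sine_series_coef// /A; ring.
Qed.

(** Integration in time over a slab cut at t produces [slab_mass], and the [dt^-1] of the load turns
    it into a slab mean: the weights are the values of g_k. *)
Lemma uhatE {d : measure_display} {Omega : measurableType d} (P : probability Omega R)
    (W : (R * R -> R) -> {RV P >-> R}) t x w : 0 <= t ->
  uhat T W M N t x w = \sum_(0 <= n < N) \sum_(0 <= i < M)
    noise_coef T W N i.+1 n.+1 w * (mode_coef T M N i t n * eps i.+1 x).
Proof.
move=> t0; rewrite /uhat /What.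
pose r i n := noise_coef T W N i n w.
transitivity (\int[leb]_(s in `]0, t[) \sum_(0 <= n < N) \sum_(0 <= i < M)
   r i.+1 n.+1 * (dt^-1 * eps i.+1 x) *
    (\1_(time_slab T N n.+1) s * expR (- (eigval i * (t - s))))).
  apply: eq_Rintegral => s; rewrite inE/= in_itv/= => /andP[_ st].
  by rewrite -int_G_load ?subr_gt0.
have mt : measurable (`]0, t[%classic : set R) by exact: measurable_itv.
have ie n i (c : R) : leb.-integrable `]0, t[ (EFin \o (fun s =>
    c * (\1_(time_slab T N n.+1) s * expR (- (eigval i * (t - s)))))).
  apply: (@bounded_integrable_oo _ _ _ _ `|c|).
    apply: measurable_funM => //; apply: measurable_funM.
      by apply: measurable_indic; exact: measurable_itv.
    apply: measurable_funTS; apply: continuous_measurable_fun.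
    rewrite (_ : (fun s => _) = (fun s => expR (eigval i * s + (- (eigval i * t))))).
      exact: continuous_expR_affine.
    by apply/funext => s; congr expR; ring.
  move=> s; rewrite in_itv/= => /andP[_ st].
  rewrite normrM ler_piMr// normrM mulr_ile1//.
    by rewrite indicE normr_nat; case: (_ \in _).
  rewrite ger0_norm ?expR_ge0// -[leRHS]expR0 ler_expR oppr_le0.
  by rewrite mulr_ge0 ?subr_ge0 ?(ltW (eigval_gt0 _)) ?(ltW st).
rewrite Rintegral_sum//; last by move=> n; apply: integrable_sum_EFin.
apply: eq_big_nat => n /andP[_ nN]; rewrite Rintegral_sum//.
apply: eq_big_nat => i /andP[_ iM]; rewrite RintegralZl//; last first.
  by apply: eq_integrable (ie n i 1) => // s _ /=; rewrite mul1r.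
rewrite int_slab_expR ?gt_eqF ?eigval_gt0// /mode_coef iM mul1r /r.
by ring.
Qed.

Lemma step_kernelE t x : 
  (fun z : R * R => sine_series (fun k => step T N (mode_coef T M N k t) z.1 * eps k.+1 x) z.2) =
  (fun z => \sum_(0 <= n < N) \sum_(0 <= i < M)
    mode_coef T M N i t n * eps i.+1 x * (\1_(time_slab T N n.+1) z.1 * eps i.+1 z.2)).
Proof.
apply/funext => z; rewrite (@sine_series_finite _ _ M); last first.
  move=> k Mk; rewrite /step big1 ?mul0r// => n _.
  by rewrite /mode_coef ltnNge Mk/= !mul0r mulr0.
rewrite exchange_big/=; apply: eq_bigr => i _.
by rewrite /step !mulr_suml; apply: eq_bigr => n _; ring.
Qed.

Lemma summable_step t s : summable_seq (fun k => step T N (mode_coef T M N k t) s).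
Proof.
apply: (@summable_seq_finite _ _ M) => k Mk; rewrite /step big1// => n _.
by rewrite /mode_coef ltnNge Mk/= !mul0r mulr0.
Qed.

Lemma norm_step_le (b : nat -> R) s : `|step T N b s| <= \sum_(0 <= n < N) `|b n|.
Proof.
apply: (le_trans (ler_norm_sum _ _ _)); apply: ler_sum => n _.
rewrite normrM ler_piMl// indicE normr_nat; by case: (_ \in _).
Qed.

End approximate_load.
Section L2_cylinder_theory.
Context {R : realType}.
Variable T : R.
Local Notation leb := (@lebesgue_measure R).
Implicit Types (Phi Psi : R * R -> R).

Lemma measurable_cylinder : measurable (cylinder T).
Proof. by apply: measurableX; exact: measurable_itv. Qed.

Lemma L2_cylinder_bounded Phi (B : R) : measurable_fun (cylinder T) Phi ->
  (forall z, `|Phi z| <= B) -> L2_cylinder T Phi.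
Proof.
move=> mPhi PhiB; split=> //; rewrite /sqnorm_cylinder.
apply: (@le_lt_trans _ _ (\int[leb \x leb]_(z in cylinder T) (B ^+ 2)%:E)%E).
  apply: ge0_le_integral => //.
  - exact: measurable_cylinder.
  - by move=> z _; rewrite lee_fin sqr_ge0.
  - by apply/measurable_EFinP; apply: measurable_funX.
  - move=> z _; rewrite lee_fin -[leLHS]ger0_norm ?sqr_ge0// normrX lerXn2r// nnegrE//.
    by apply: le_trans (PhiB z); exact: normr_ge0.
rewrite /cylinder integral_rectangle//; first last.
- by move=> z; rewrite lee_fin sqr_ge0.
- exact: measurable_itv.
have fin (a b c : R) : (\int[leb]_(y in `]a, b[) c%:E)%E \is a fin_num.
  apply: integrable_fin_num; first exact: measurable_itv.
  exact: (@bounded_integrable_oo _ (fun=> c) a b `|c|).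
rewrite (eq_integral (fun=> (fine (\int[leb]_(y in (@domD R)) (B ^+ 2)%:E)%E)%:E)).
  by rewrite ltey_eq fin.
by move=> s _; rewrite fineK//; exact: fin.
Qed.

Lemma L2_cylinder_lin (a b : R) Phi Psi : L2_cylinder T Phi -> L2_cylinder T Psi ->
  L2_cylinder T (fun z => a * Phi z + b * Psi z).
Proof.
move=> [mPhi fPhi] [mPsi fPsi].
have mc := measurable_cylinder.
have mP : measurable_fun (cylinder T) (fun z => (Phi z ^+ 2)%:E).
  by apply/measurable_EFinP; apply: measurable_funX.
have mQ : measurable_fun (cylinder T) (fun z => (Psi z ^+ 2)%:E).
  by apply/measurable_EFinP; apply: measurable_funX.
have mL : measurable_fun (cylinder T) (fun z => a * Phi z + b * Psi z).
  by apply: measurable_funD; apply: measurable_funM.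
have p1 (c : R) : 0 <= 2 * c ^+ 2 by rewrite mulr_ge0 ?sqr_ge0.
have p2 (c y : R) : 0 <= 2 * c ^+ 2 * y ^+ 2 by rewrite mulr_ge0 ?sqr_ge0.
split=> //; rewrite /sqnorm_cylinder.
apply: (@le_lt_trans _ _ (\int[leb \x leb]_(z in cylinder T)
    ((2 * a ^+ 2)%:E * (Phi z ^+ 2)%:E + (2 * b ^+ 2)%:E * (Psi z ^+ 2)%:E))%E).
  apply: ge0_le_integral => //.
  - by move=> z _; rewrite lee_fin sqr_ge0.
  - by apply/measurable_EFinP; apply: measurable_funX.
  - by apply: emeasurable_funD; apply: measurable_funeM.
  - move=> z _; rewrite -!EFinM -EFinD lee_fin -subr_ge0.
    (* Parallelogram identity: the gap between the two sides is a square. *)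
    rewrite (_ : _ - _ = (a * Phi z - b * Psi z) ^+ 2) ?sqr_ge0//.
    by ring.
rewrite ge0_integralD//; first last.
- by apply: measurable_funeM.
- by move=> z _; rewrite -EFinM lee_fin p2.
- by apply: measurable_funeM.
- by move=> z _; rewrite -EFinM lee_fin p2.
have q0 (f : R * R -> R) z : cylinder T z -> (0 <= (f z ^+ 2)%:E)%E.
  by move=> _; rewrite lee_fin sqr_ge0.
have ZP := ge0_integralZl_EFin (leb \x leb)%E mc (q0 Phi) mP (p1 a).
have ZQ := ge0_integralZl_EFin (leb \x leb)%E mc (q0 Psi) mQ (p1 b).
rewrite [X in (X + _)%E]ZP [X in (_ + X)%E]ZQ.
by apply: lte_add_pinfty; apply: lte_mul_pinfty => //; rewrite lee_fin p1.
Qed.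

End L2_cylinder_theory.

(** * Wiener integrals *)

Section noise.
Context {R : realType} {d : measure_display} {Omega : measurableType d}.
Variables (P : probability Omega R) (T : R).
Variable W : (R * R -> R) -> {RV P >-> R}.
Hypothesis W_noise : space_time_white_noise T W.

(** Each use of linearity costs a null set; a finite sum collects finitely many of them. *)
Lemma white_noise_sum (I : Type) (r : seq I) (c : I -> R) (Phi : I -> R * R -> R) :
  (forall i, L2_cylinder T (Phi i)) ->
  L2_cylinder T (fun z => \sum_(i <- r) c i * Phi i z) /\
  {ae P, forall w, W (fun z => \sum_(i <- r) c i * Phi i z) w =
    \sum_(i <- r) c i * W (Phi i) w}.
Proof.
move=> L2Phi.
have L20 : L2_cylinder T (fun=> 0).
  by apply: (@L2_cylinder_bounded _ _ _ 0) => // z; rewrite normr0.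
elim: r => [|i r [L2r IH]].
  (* Written in this way, the zero function is an instance of linearity, which gives [W] of it the
     value 0 almost surely. *)
  have -> : (fun z : R * R => \sum_(i <- [::]) c i * Phi i z) = (fun z => 0 * 0 + 0 * 0).
    by apply/funext => z; rewrite big_nil mulr0 addr0.
  split; first exact: L2_cylinder_lin.
  have := white_noise_linear W_noise 0 0 L20 L20.
  by apply: filterS => w ->; rewrite big_nil !mul0r addr0.
have -> : (fun z : R * R => \sum_(j <- i :: r) c j * Phi j z) =
    (fun z => c i * Phi i z + 1 * \sum_(j <- r) c j * Phi j z).
  by apply/funext => z; rewrite big_cons mul1r.
split; first exact: L2_cylinder_lin.
have lin := white_noise_linear W_noise (c i) 1 (L2Phi i) L2r.
by apply: filterS2 lin IH => w -> ->; rewrite big_cons mul1r.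
Qed.

Section error.
Variables (M N : nat).
Hypotheses (T_gt0 : 0 < T) (N_gt0 : (0 < N)%N).
Local Notation leb := (@lebesgue_measure R).
Local Notation D := (@domD R).
Variable u : R -> R -> Omega -> R.
Hypothesis u_conv : stochastic_convolution T W u.
Implicit Types (t x : R).

(** The singularity at s = t is square integrable: integration in time turns the square of mode k
    into at most 1 / (2 lambda_k^4), which is summable. The 4 below is the square of the bound 2 on
    [eps]. *)
Lemma L2_heat_kernel t x : 0 <= t <= T ->
  L2_cylinder T (fun z => sine_series (fun k => decay (eigval k) t z.1 * eps k.+1 x) z.2).
Proof.
move=> tT; split.
  apply: (@measurable_sine_kernel _ (fun k s => decay (eigval k) t s * eps k.+1 x)).
    by move=> k; apply: measurable_funM => //; exact: measurable_decay.
  by move=> s; apply: summable_seq_mul_eps; exact: summable_decay.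
have e0 k : 0 < eigval k :> R by exact: eigval_gt0.
rewrite (@sqnorm_mode_kernel _ _ (fun k => decay (eigval k) t) (fun=> 1)
  (fun k => decay_mass (2 * eigval k) t)); first last.
- move=> k; under eq_Rintegral do rewrite decay_sqr.
  by rewrite int_decay// mulf_neq0// gt_eqF.
- by move=> k s; rewrite ger0_norm ?decay_ge0// decay_le1// ltW.
- by move=> s; exact: summable_decay.
- by move=> k; exact: measurable_decay.
have dm k : 0 <= decay_mass (2 * eigval k) t.
  by apply: decay_mass_ge0; [rewrite mulr_gt0|case/andP : tT].
rewrite nneseries_EFin_limn ?ltry//.
apply: (@series_le_cvg _ _ (fun k => 4 * k.+1%:R ^- 4)) => [k|k|k|].
- by rewrite mulr_ge0 ?sqr_ge0.
- by rewrite mulr_ge0// invr_ge0 exprn_ge0.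
- apply: ler_pM; rewrite ?sqr_ge0//.
  + rewrite -[leLHS]ger0_norm ?sqr_ge0// normrX (_ : 4 = 2 ^+ 2); last by rewrite expr2; ring.
    by rewrite lerXn2r ?nnegrE ?norm_eps_le.
  + by apply: le_trans (inv_eigval_le k); apply: decay_mass_le; rewrite mulr_gt0.
- by apply/cvg_ex; eexists; exact: cvg_series_mull (@cvg_series_inv_quartic R).
Qed.

Lemma L2_slab_mode n i : L2_cylinder T (fun z => \1_(time_slab T N n.+1) z.1 * eps i.+1 z.2).
Proof.
apply: (@L2_cylinder_bounded _ _ _ 2).
  apply: measurable_funTS; apply: measurable_funM.
    apply: measurableT_comp measurable_fst; apply: measurable_indic; exact: measurable_itv.
  exact: measurableT_comp (@measurable_eps R i.+1 setT) measurable_snd.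
move=> z; rewrite normrM -[leRHS]mul1r ler_pM// ?norm_eps_le//.
by rewrite indicE normr_nat; case: (_ \in _).
Qed.

(** The kernel whose Wiener integral is [uhat]. Only finitely many coefficients are nonzero, but the
    form of a sine series allows subtraction from the heat kernel coefficient by coefficient. *)
Definition step_kernel t x (z : R * R) : R :=
  sine_series (fun k => step T N (mode_coef T M N k t) z.1 * eps k.+1 x) z.2.

Lemma uhat_noise t x : 0 <= t ->
  L2_cylinder T (step_kernel t x) /\
  {ae P, forall w, W (step_kernel t x) w = uhat T W M N t x w}.
Proof.
move=> t0; rewrite /step_kernel step_kernelE.
pose r := [seq (n, i) | n <- index_iota 0 N, i <- index_iota 0 M].
pose c (p : nat * nat) := mode_coef T M N p.2 t p.1 * eps p.2.+1 x.
pose Phi (p : nat * nat) (z : R * R) : R := \1_(time_slab T N p.1.+1) z.1 * eps p.2.+1 z.2.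
have [L2r aer] := @white_noise_sum _ r c Phi (fun p => L2_slab_mode p.1 p.2).
have E : (fun z : R * R => \sum_(p <- r) c p * Phi p z) =
    (fun z => \sum_(0 <= n < N) \sum_(0 <= i < M)
      mode_coef T M N i t n * eps i.+1 x * (\1_(time_slab T N n.+1) z.1 * eps i.+1 z.2)).
  by apply/funext => z; rewrite big_allpairs_dep.
rewrite -E; split=> //.
apply: filterS aer => w ->; rewrite uhatE// big_allpairs_dep.
by apply: eq_bigr => n _; apply: eq_bigr => i _; rewrite mulrC.
Qed.

Definition error_kernel t x (z : R * R) : R :=
  sine_series (fun k =>
    (decay (eigval k) t z.1 - step T N (mode_coef T M N k t) z.1) * eps k.+1 x) z.2.

(** The exceptional null set depends on x. This is harmless, since the expectation is computed at
    fixed x before the integration over x. *)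
Lemma error_noise t x : 0 <= t <= T -> x \in D ->
  L2_cylinder T (error_kernel t x) /\
  {ae P, forall w, W (error_kernel t x) w = u t x w - uhat T W M N t x w}.
Proof.
move=> tT xD; have [t0 _] := andP tT.
have tT' : t \in `[0, T] by rewrite in_itv.
have [_ /(_ x xD) uW] := u_conv tT'.
have [L2s sW] := uhat_noise x t0.
have L2h := L2_heat_kernel x tT.
have lin := white_noise_linear W_noise 1 (-1) L2h L2s.
rewrite heat_kernelE in uW.
have E : (fun z : R * R => 1 * sine_series (fun k => decay (eigval k) t z.1 * eps k.+1 x) z.2 +
    -1 * step_kernel t x z) = error_kernel t x.
  apply/funext => z; rewrite mul1r mulN1r /step_kernel /error_kernel -sine_seriesB; first last.
  - by apply: summable_seq_mul_eps; exact: summable_step.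
  - by apply: summable_seq_mul_eps; exact: summable_decay.
  by congr sine_series; apply/funext => k; rewrite mulrBl.
rewrite -E; split; first exact: L2_cylinder_lin.
apply: filterS3 uW sW lin => w -> <- ->.
by rewrite mul1r mulN1r.
Qed.

End error.
End noise.

(** * The mean square error *)

Section mean_square.
Context {R : realType} {d : measure_display} {Omega : measurableType d}.
Variables (P : probability Omega R) (T : R).
Variable W : (R * R -> R) -> {RV P >-> R}.
Hypothesis W_noise : space_time_white_noise T W.
Variables (M N : nat).
Hypotheses (T_gt0 : 0 < T) (N_gt0 : (0 < N)%N).
Local Notation leb := (@lebesgue_measure R).
Local Notation D := (@domD R).
Variable u : R -> R -> Omega -> R.
Hypothesis u_conv : stochastic_convolution T W u.
Implicit Types (t x : R).

Lemma measurable_error t : 0 <= t <= T ->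
  measurable_fun (D `*` [set: Omega])
    (fun z : R * Omega => u t z.1 z.2 - uhat T W M N t z.1 z.2).
Proof.
move=> tT; have [t0 _] := andP tT.
have tT' : t \in `[0, T] by rewrite in_itv.
apply: measurable_funB; first by have [] := u_conv tT'.
under eq_fun do rewrite uhatE//.
apply: measurable_funTS; apply: measurable_sum => n; apply: measurable_sum => i.
apply: measurable_funM.
  exact: measurableT_comp measurable_snd.
apply: measurable_funM => //.
exact: measurableT_comp (@measurable_eps R i.+1 setT) measurable_fst.
Qed.

Lemma mean_square_error_at t x : 0 <= t <= T -> x \in D ->
  (\int[P]_w ((u t x w - uhat T W M N t x w) ^+ 2)%:E =
   \sum_(k <oo) (eps k.+1 x ^+ 2 * mode_err T M N k t)%:E)%E.
Proof.
move=> tT xD.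
have [L2K aeW] := error_noise W_noise M T_gt0 N_gt0 u_conv tT xD.
transitivity ('E_P[fun w => (W (error_kernel T M N t x) w ^+ 2)%R])%E.
  rewrite expectation.unlock; apply: ge0_ae_eq_integral => //.
  - apply/measurable_EFinP; apply: measurable_funX.
    rewrite (_ : (fun w => _) =
      (fun z : R * Omega => u t z.1 z.2 - uhat T W M N t z.1 z.2) \o pair x)//.
    apply: (measurable_comp _ _ (measurable_error tT)).
    - by apply: measurableX => //; exact: measurable_itv.
    - by move=> _ [w _ <-]; split=> //=; rewrite -inE.
    - exact: measurableT_comp.
  - apply/measurable_EFinP; apply: measurable_funX => //.
  - by move=> w _; rewrite lee_fin sqr_ge0.
  - by move=> w _; rewrite lee_fin sqr_ge0.
  - by apply: filterS aeW => w Ww _; rewrite Ww.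
rewrite (white_noise_isometry W_noise L2K).
apply: (@sqnorm_mode_kernel _ _
  (fun k s => decay (eigval k) t s - step T N (mode_coef T M N k t) s)
  (fun k => 1 + \sum_(0 <= n < N) `|mode_coef T M N k t n|)).
- by move=> k; apply: measurable_funB; [exact: measurable_decay|exact: measurable_step].
- by move=> s; apply: summable_seqB; [exact: summable_decay|exact: summable_step].
- move=> k s; apply: le_trans (ler_normB _ _) _; apply: lerD; last exact: norm_step_le.
  by rewrite ger0_norm ?decay_ge0// decay_le1// ltW// eigval_gt0.
- by move=> k; exact: int_sqr_mode.
Qed.

(** Tonelli moves the expectation inside the integral over x, which is where the joint measurability
    of [u] enters. The dependence on x is then only through eps_k(x)^2, of integral 1. *)
Lemma mean_square_error t : 0 <= t <= T ->
  (\int[P]_w \int[leb]_(x in D) ((u t x w - uhat T W M N t x w) ^+ 2)%:E =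
   (total_err T M N t)%:E)%E.
Proof.
move=> tT.
have mD : measurable D by exact: measurable_itv.
rewrite -(@integral_rectangle_swap _ _ _ _ _ leb P D setT
  (fun z => ((u t z.1 z.2 - uhat T W M N t z.1 z.2) ^+ 2)%:E))//; first last.
- by move=> z; rewrite lee_fin sqr_ge0.
- by apply/measurable_EFinP; apply: measurable_funX; exact: measurable_error.
transitivity (\int[leb]_(x in D) \sum_(k <oo) (eps k.+1 x ^+ 2 * mode_err T M N k t)%:E)%E.
  by apply: eq_integral => x xD; rewrite mean_square_error_at.
have m0 k : 0 <= mode_err T M N k t by exact: mode_err_ge0.
rewrite integral_nneseries//; first last.
- by move=> k x _; rewrite lee_fin mulr_ge0 ?sqr_ge0.
- move=> k; apply/measurable_EFinP; apply: measurable_funM => //.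
  by apply: measurable_funX; exact: measurable_eps.
rewrite /total_err -nneseries_EFin_limn; last exact: is_cvg_total_err.
apply: eq_eseriesr => k _.
have mE : measurable_fun D (fun x => (eps k.+1 x ^+ 2)%:E).
  by apply/measurable_EFinP; apply: measurable_funX; exact: measurable_eps.
have E0 (x : R) : D x -> (0 <= (eps k.+1 x ^+ 2)%:E)%E by rewrite lee_fin sqr_ge0.
have Z := ge0_integralZl_EFin leb mD E0 mE (m0 k).
rewrite int_eps_sqr mule1 in Z; rewrite -[RHS]Z.
by apply: eq_integral => x _; rewrite mulrC EFinM.
Qed.

Lemma rms_error t : 0 <= t <= T ->
  rms_L2_dist P (u t) (uhat T W M N t) = (total_err T M N t `^ (1 / 2))%:E.
Proof. by move=> tT; rewrite /rms_L2_dist mean_square_error// poweR_EFin. Qed.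

End mean_square.

(** * The maximum in time and the final estimate *)

Lemma exists_max_rms {R : realType} {d : measure_display} {Omega : measurableType d}
    (P : probability Omega R) (T : R) (W : (R * R -> R) -> {RV P >-> R}) (M N : nat)
    (u : R -> R -> Omega -> R) :
  space_time_white_noise T W -> stochastic_convolution T W u ->
  0 < T -> (0 < N)%N ->
  exists2 t, 0 <= t <= T &
    is_max_on `[0, T] (fun t => rms_L2_dist P (u t) (uhat T W M N t))
      (total_err T M N t `^ (1 / 2))%:E.
Proof.
move=> W_noise u_conv T0 N0.
have [t tT tmax] := EVT_max (ltW T0) (continuous_total_err (M := M) T0 N0).
rewrite in_itv/= in tT; exists t => //.
have E s : s \in `[0, T] -> rms_L2_dist P (u s) (uhat T W M N s) = (total_err T M N s `^ (1 / 2))%:E.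
  by rewrite in_itv/= => sT; exact: rms_error.
split; first by exists t; [rewrite inE/= in_itv|rewrite E// in_itv].
move=> s; rewrite inE/= => sT; rewrite (E _ sT) lee_fin.
have sT' : 0 <= s <= T by move: sT; rewrite in_itv.
have err_s : 0 <= total_err T M N s by exact: total_err_ge0.
have err_t : 0 <= total_err T M N t by exact: total_err_ge0.
(* The square root is increasing, so the maximiser of [total_err] also maximises its root. *)
by apply: ge0_ler_powR; rewrite ?nnegrE ?divr_ge0 ?tmax.
Qed.


Theorem theorem3p1 (R : realType) (T : R) (T_gt0 : 0 < T)
    (d : measure_display) (Omega : measurableType d) (P : probability Omega R)
    (P_complete : measure_is_complete P)
    (W : (R * R -> R) -> {RV P >-> R}) (W_noise : space_time_white_noise T W)
    (u : R -> R -> Omega -> R) (u_conv : stochastic_convolution T W u) :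
  exists C : R, 0 < C /\
    forall M N : nat, (0 < M)%N -> (0 < N)%N ->
      exists m : \bar R,
        is_max_on `[0, T]
          (fun t => rms_L2_dist P (u t) (uhat T W M N t)) m /\
        forall delta : R, 0 < delta -> delta <= 3 / 2 ->
          (m <= (C * (dt T N `^ (3 / 8) +
                      delta `^ (- (1 / 2)) * M%:R `^ (- (3 / 2) + delta)))%:E)%E.
Proof.
(* The 3 comes from sqrt(8 A^2 + B^2) <= 3 A + B. It also covers the second term, as 3 delta^{-1/2}
   M^delta >= 3 / 2. *)
exists 3; split=> // M N M0 N0.
have [t tT tmax] := exists_max_rms M W_noise u_conv T_gt0 N0.
exists (total_err T M N t `^ (1 / 2))%:E; split=> // delta d0 d32.
rewrite lee_fin.
have h0 := dt_gt0 T_gt0 N0.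
have M1 : 1 <= M%:R :> R by rewrite ler1n.
have Mpos : 0 < M%:R :> R by rewrite ltr0n.
set A := dt T N `^ (3 / 8); set B : R := M%:R `^ (- (3 / 2)).
have A0 : 0 <= A by exact: powR_ge0.
have B0 : 0 <= B by exact: powR_ge0.
have AA : A ^+ 2 = dt T N `^ (3 / 4).
  by rewrite -powR_mulrn// -powRrM; congr (_ `^ _); field.
have BB : B ^+ 2 = M%:R ^- 3.
  rewrite -powR_mulrn// -powRrM (_ : - (3 / 2) * 2 = - 3%:R); last by field.
  by rewrite powRN powR_mulrn// ltW.
have errAB : total_err T M N t `^ (1 / 2) <= 3 * A + B.
  have AB0 : 0 <= 3 * A + B by rewrite addr_ge0// mulr_ge0.
  rewrite -[leRHS]ger0_norm// -sqrtr_sqr div1r powR12_sqrt ?total_err_ge0//.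
  apply: ler_wsqrtr; apply: le_trans (total_err_le T_gt0 M0 N0 tT) _.
  by rewrite -AA -BB; nra.
apply: le_trans errAB _; rewrite mulrDr lerD2l.
have -> : M%:R `^ (- (3 / 2) + delta) = B * M%:R `^ delta.
  by apply: powRD; apply/implyP => _; rewrite gt_eqF.
have Md : 1 <= M%:R `^ delta by rewrite -[leLHS](powRr0 M%:R) ler_powR// ltW.
(* The upper bound on delta is used here: delta <= 3 / 2 < 4 keeps its root below 2. *)
have dd : 1 / 2 <= delta `^ (- (1 / 2)).
  have d2 : delta `^ (1 / 2) <= 2.
    rewrite (_ : 1 / 2 = 2^-1); last by rewrite div1r.
    rewrite powR12_sqrt ?(ltW d0)//.
    rewrite -[leRHS]ger0_norm// -sqrtr_sqr; apply: ler_wsqrtr.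
    by apply: le_trans d32 _; lra.
  have dX : 0 < delta `^ (1 / 2) by exact: powR_gt0.
  rewrite powRN; set X := delta `^ (1 / 2) in d2 dX *.
  by rewrite ler_pdivrMr// mulrC ler_pdivlMr// mul1r.
have Bd : B <= B * M%:R `^ delta by rewrite ler_peMr.
by nra.
Qed.
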